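(* Let $(g,h,H,f)$ be admissible strongly convex data with modulus $\gamma>0$, fix a saddle point $(x^*,y^* )\in\Omega$, and let $\{(z_n,x_n,y_n,\beta_n,\tau_n):n\ge1\}$ be generated by the algorithm aNPDAL-n. Then there exist constants $C_1>0$ and $c_3>0$ such that for every $N\ge1$, $$\|x_{N+1}-x^*\|\le\frac{C_1}{N+1},\qquad J(\hat x_N,\hat y_N)\le\frac{\beta_1}{c_3}\,\frac{A_1}{N^2},$$ where $J(x,y)=\mathcal{L}(x,y^* )-\mathcal{L}(x^*,y)$, $$\hat x_N=\frac1{s_N}\sum_{n=1}^N\beta_n\tau_nx_n,\qquad \hat y_N=\frac1{s_N}\sum_{n=1}^N\beta_n\tau_ny_n,\qquad s_N=\sum_{n=1}^N\beta_n\tau_n,$$ and $$A_1=a\|x_1-x^*\|^2+\frac{(1-a)\psi+(1-a)\gamma\tau_1}{\psi-1}\|z_2-x^*\|^2+\Bigl(a+\frac{\kappa_0\beta_0}{\beta_1}\Bigr)\|x_1-x_0\|^2+\frac b{\beta_1}\|y_0-y^*\|^2+\frac1{\beta_1}\|\bar z_1-y^*\|^2 .$$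
   Context: **Problem.** $\min_{x\in\mathbb{R}^q}\max_{y\in\mathbb{R}^p}\mathcal{L}(x,y):=g(x)+h(x)+\langle H(x),y\rangle-f^*(y)$, where $g:\mathbb{R}^q\to(-\infty,+\infty]$, $f:\mathbb{R}^p\to(-\infty,+\infty]$ are proper, closed, convex, $f^*$ is the Legendre–Fenchel conjugate of $f$, $h:\mathbb{R}^q\to\mathbb{R}$ is convex with $L_h$-Lipschitz gradient ($L_h>0$), and $H:\mathrm{dom}(g)\to\mathrm{dom}(f)$ is (nonlinear) continuously differentiable. Put $\Phi(x,y)=h(x)+\langle H(x),y\rangle$. A saddle point is a pair $(x^*,y^* )\in\mathrm{dom}(g)\times\mathrm{dom}(f^* )$ with $\mathcal{L}(x^*,y)\le\mathcal{L}(x^*,y^* )\le\mathcal{L}(x,y^* )$ for all $(x,y)\in\mathrm{dom}(g)\times\mathrm{dom}(f^* )$; $\Omega$ is the set of saddle points. **Admissible strongly convex data** means: $\Omega\neq\emptyset$ and $\mathcal{L}(x^*,y^* )$ is finite; for every $y\in\mathrm{dom}(f^* )$ the function $x\mapsto\langle H(x),y\rangle$ is convex on $\mathrm{dom}(g)$; for any bounded $\mathcal{X}\subset\mathbb{R}^q$, $\mathcal{Y}\subset\mathbb{R}^p$ there are $L_{xx}\ge0$, $L_{xy}>0$ with $\|\nabla_x\Phi(x,y)-\nabla_x\Phi(\tilde x,\tilde y)\|\le L_{xx}\|x-\tilde x\|+L_{xy}\|y-\tilde y\|$ for all $x,\tilde x\in\mathcal{X}\cap\mathrm{dom}(g)$,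 $y,\tilde y\in\mathcal{Y}\cap\mathrm{dom}(f^* )$; and $g$ is strongly convex with modulus $\gamma>0$: $g(x)\ge g(\tilde x)+\langle\zeta,x-\tilde x\rangle+\frac\gamma2\|x-\tilde x\|^2$ for all $x,\tilde x\in\mathrm{dom}(g)$, $\zeta\in\partial g(\tilde x)$. $\mathrm{Prox}_{\lambda\phi}(x)=\operatorname{argmin}_u\{\phi(u)+\frac1{2\lambda}\|u-x\|^2\}$. **Algorithm aNPDAL-n.** Parameters: $\psi\in(1,1+\sqrt3)$, $a\in(0,1)$, $b\in[0,1)$, $\xi>0$, $1<\varphi<\psi$, $0<\xi_1<1/\varphi$ such that $\omega_1:=(1-a)\bigl(2\psi-\xi-\frac{\psi^3\varphi}{1+\psi}\bigr)-\frac a{\xi_1}>0$; $\tau_{\max}>0$, $\mu\in(0,1)$, $\beta_0>0$, $\delta_0>0$, $\tau_0\in(0,\tau_{\max}]$. Start: $x_0\in\mathrm{dom}(g)$, $y_0\in\mathrm{dom}(f^* )$, $z_0=x_0$, $\bar z_0=y_0$. For $n=1,2,\dots$: 1. $\kappa_{n-1}=\omega_1\delta_{n-1}+(1-a)\gamma\tau_{n-1}$, $\rho_n=\frac{\psi-\varphi}{\psi+\gamma\varphi\tau_{n-1}}$, $\beta_n=(1+\gamma\rho_n\tau_{n-1})\beta_{n-1}$. 2. $z_n=\frac{\psi-1}\psi x_{n-1}+\frac1\psi z_{n-1}$, $x_n^{md}=ax_{n-1}+(1-a)z_n$, $x_n=\mathrm{Prox}_{\tau_{n-1}g}(x_n^{md}-\tau_{n-1}\nabla_x\Phi(x_{n-1},y_{n-1}))$.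 3. $\bar z_n=(1-b)y_{n-1}+b\bar z_{n-1}$, $y_n^{md}=by_{n-1}+(1-b)\bar z_n$. 4. (Linesearch) With $\tau=\min\{\varphi\tau_{n-1},\tau_{\max}\}$, let $\tau_n=\tau\mu^i$ with $i$ the first of $0,1,2,\dots$ for which, with $y_n=\mathrm{Prox}_{\beta_n\tau_nf^*}(y_n^{md}+\beta_n\tau_n\nabla_y\Phi(x_n,y_{n-1}))$ and $\theta_n=\nabla_x\Phi(x_n,y_n)-\nabla_x\Phi(x_{n-1},y_{n-1})$, $$\frac{\tau_n\tau_{n-1}}{(1-a)\xi}\|\theta_n\|^2\le\frac{\kappa_{n-1}\beta_{n-1}}{\beta_n}\|x_n-x_{n-1}\|^2+\frac b{\beta_n}\|y_n-y_{n-1}\|^2+\frac1{\beta_n}(1-b)(1+b)\|y_n-\bar z_n\|^2 .$$ 5. $\delta_n=\tau_n/\tau_{n-1}$. *)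

(* Defs.v *)
(* MathComp / MathComp-Analysis: vectors of R^n are row vectors 'rV[R]_n.  The
   library norm `|x| on 'rV[R]_n is the sup norm; it is used only for topological
   notions (differentiability, continuity, boundedness, semicontinuity), where the
   choice of norm is immaterial.  All estimates use the Euclidean norm [enorm]. *)
From HB Require Import structures.
From mathcomp Require Import all_boot all_order all_algebra.
From mathcomp Require Import all_classical all_reals all_analysis.

Set Implicit Arguments.
Unset Strict Implicit.
Unset Printing Implicit Defensive.

Import Order.TTheory GRing.Theory Num.Theory.
Import numFieldNormedType.Exports.

Local Open Scope classical_set_scope.
Local Open Scope ring_scope.

Definition dotv (R : realType) (n : nat) (u v : 'rV[R]_n) : R :=
  \sum_(i < n) u 0 i * v 0 i.

Definition enorm (R : realType) (n : nat) (u : 'rV[R]_n) : R :=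
  Num.sqrt (dotv u u).

Definition grad (R : realType) (n : nat) (phi : 'rV[R]_n -> R) (x : 'rV[R]_n) :
    'rV[R]_n :=
  \row_(i < n) 'D_(delta_mx 0 i) phi x.

Definition edom (R : realType) (n : nat) (phi : 'rV[R]_n -> \bar R) :
    set 'rV[R]_n :=
  [set x | (phi x < +oo)%E].

Definition proper (R : realType) (n : nat) (phi : 'rV[R]_n -> \bar R) : Prop :=
  (forall x, (-oo < phi x)%E) /\ edom phi !=set0.

Definition econvex (R : realType) (n : nat) (phi : 'rV[R]_n -> \bar R) : Prop :=
  forall (x y : 'rV[R]_n) (t : R), 0 < t -> t < 1 ->
    (phi (t *: x + (1 - t) *: y)%R <= t%:E * phi x + (1 - t)%:E * phi y)%E.

(* For extended-real-valued functions, closed means lower semicontinuous. *)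
Definition proper_closed_convex (R : realType) (n : nat)
    (phi : 'rV[R]_n -> \bar R) : Prop :=
  [/\ proper phi, lower_semicontinuous phi & econvex phi].

Definition conjugate (R : realType) (n : nat) (phi : 'rV[R]_n -> \bar R)
    (y : 'rV[R]_n) : \bar R :=
  ereal_sup [set ((dotv x y)%:E - phi x)%E | x in [set: 'rV[R]_n]].

Definition subdifferential (R : realType) (n : nat) (phi : 'rV[R]_n -> \bar R)
    (x : 'rV[R]_n) : set 'rV[R]_n :=
  [set zeta | forall u, (phi x + (dotv zeta (u - x))%:E <= phi u)%E].

Definition strongly_convex (R : realType) (n : nat) (gamma : R)
    (phi : 'rV[R]_n -> \bar R) : Prop :=
  forall x x' zeta : 'rV[R]_n,
    edom phi x -> edom phi x' -> subdifferential phi x' zeta ->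
    (phi x' + (dotv zeta (x - x') + gamma / 2 * enorm (x - x') ^+ 2)%:E
       <= phi x)%E.

(* The argmin, as a set of minimisers; for phi proper, closed and convex and
   lambda > 0 it is a singleton, and "u = Prox_(lambda phi)(x)" is written
   [prox lambda phi x u]. *)
Definition prox (R : realType) (n : nat) (lambda : R)
    (phi : 'rV[R]_n -> \bar R) (x : 'rV[R]_n) : set 'rV[R]_n :=
  [set u | forall v,
    (phi u + (1 / (2 * lambda) * enorm (u - x) ^+ 2)%:E
       <= phi v + (1 / (2 * lambda) * enorm (v - x) ^+ 2)%:E)%E].

(* f and g are extended-real-valued.  H : dom g -> dom f is the restriction of the
   total function [pH]; dom g need not be open, so "C^1 on dom g" is read as: [pH]
   is differentiable at the points of dom g, with Jacobian continuous on dom g.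
   No other property of [pH] outside dom g is assumed. *)
Record problem (R : realType) (q p : nat) := Problem {
  pg : 'rV[R]_q -> \bar R;
  ph : 'rV[R]_q -> R;
  pH : 'rV[R]_q -> 'rV[R]_p;
  pf : 'rV[R]_p -> \bar R }.

Definition Phi (R : realType) (q p : nat) (D : problem R q p)
    (x : 'rV[R]_q) (y : 'rV[R]_p) : R :=
  ph D x + dotv (pH D x) y.

Definition gradx_Phi (R : realType) (q p : nat) (D : problem R q p)
    (x : 'rV[R]_q) (y : 'rV[R]_p) : 'rV[R]_q :=
  grad (fun u => Phi D u y) x.

Definition grady_Phi (R : realType) (q p : nat) (D : problem R q p)
    (x : 'rV[R]_q) (y : 'rV[R]_p) : 'rV[R]_p :=
  grad (fun v => Phi D x v) y.

Definition Lagr (R : realType) (q p : nat) (D : problem R q p)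
    (x : 'rV[R]_q) (y : 'rV[R]_p) : \bar R :=
  (pg D x + (ph D x)%:E + (dotv (pH D x) y)%:E - conjugate (pf D) y)%E.

Definition saddle_point (R : realType) (q p : nat) (D : problem R q p)
    (xs : 'rV[R]_q) (ys : 'rV[R]_p) : Prop :=
  [/\ edom (pg D) xs, edom (conjugate (pf D)) ys
    & forall x y, edom (pg D) x -> edom (conjugate (pf D)) y ->
        (Lagr D xs y <= Lagr D xs ys)%E /\ (Lagr D xs ys <= Lagr D x ys)%E].

Record standing_assumptions (R : realType) (q p : nat) (D : problem R q p) :
    Prop := {
  sa_g : proper_closed_convex (pg D);
  sa_f : proper_closed_convex (pf D);
  sa_h_convex : convex_function [set: 'rV[R]_q] (ph D);
  sa_h_diff : forall x, differentiable (ph D) x;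
  sa_h_lip : exists2 Lh : R, 0 < Lh &
    forall x x', enorm (grad (ph D) x - grad (ph D) x') <= Lh * enorm (x - x');
  sa_H_dom : forall x, edom (pg D) x -> edom (pf D) (pH D x);
  sa_H_diff : forall x, edom (pg D) x -> differentiable (pH D) x;
  sa_H_C1 : {within edom (pg D), continuous (jacobian (pH D))} }.

Record admissible_strongly_convex (R : realType) (q p : nat)
    (D : problem R q p) (gamma : R) : Prop := {
  asc_standing : standing_assumptions D;
  asc_saddle : exists xs ys, saddle_point D xs ys;
  asc_finite : forall xs ys, saddle_point D xs ys -> Lagr D xs ys \is a fin_num;
  asc_H_convex : forall y, edom (conjugate (pf D)) y ->
    convex_function (edom (pg D)) (fun x => dotv (pH D x) y);
  asc_lip : forall (X : set 'rV[R]_q) (Y : set 'rV[R]_p),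
    bounded_set X -> bounded_set Y ->
    exists Lxx Lxy : R, [/\ 0 <= Lxx, 0 < Lxy &
      forall x x' y y',
        (X `&` edom (pg D)) x -> (X `&` edom (pg D)) x' ->
        (Y `&` edom (conjugate (pf D))) y ->
        (Y `&` edom (conjugate (pf D))) y' ->
        enorm (gradx_Phi D x y - gradx_Phi D x' y')
          <= Lxx * enorm (x - x') + Lxy * enorm (y - y')];
  asc_gamma : 0 < gamma;
  asc_g : strongly_convex gamma (pg D) }.

Record parameters (R : realType) := MkParameters {
  psi_ : R;
  a_ : R;
  b_ : R;
  xi_ : R;
  vphi_ : R;
  xi1_ : R;
  taumax_ : R;
  mu_ : R;
  beta0_ : R;
  delta0_ : R;
  tau0_ : R }.

Definition omega1 (R : realType) (P : parameters R) : R :=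
  (1 - a_ P) * (2 * psi_ P - xi_ P - psi_ P ^+ 3 * vphi_ P / (1 + psi_ P))
    - a_ P / xi1_ P.

Record valid_parameters (R : realType) (P : parameters R) : Prop := {
  vp_psi : 1 < psi_ P < 1 + Num.sqrt 3;
  vp_a : 0 < a_ P < 1;
  vp_b : 0 <= b_ P < 1;
  vp_xi : 0 < xi_ P;
  vp_vphi : 1 < vphi_ P < psi_ P;
  vp_xi1 : 0 < xi1_ P < 1 / vphi_ P;
  vp_omega1 : 0 < omega1 P;
  vp_taumax : 0 < taumax_ P;
  vp_mu : 0 < mu_ P < 1;
  vp_beta0 : 0 < beta0_ P;
  vp_delta0 : 0 < delta0_ P;
  vp_tau0 : 0 < tau0_ P <= taumax_ P }.

(* [zb] is z-bar. *)
Record iterates (R : realType) (q p : nat) := Iterates {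
  x_ : nat -> 'rV[R]_q;
  y_ : nat -> 'rV[R]_p;
  z_ : nat -> 'rV[R]_q;
  zb_ : nat -> 'rV[R]_p;
  beta_ : nat -> R;
  tau_ : nat -> R;
  delta_ : nat -> R }.

Definition kappa (R : realType) (q p : nat) (gamma : R) (P : parameters R)
    (it : iterates R q p) (n : nat) : R :=
  omega1 P * delta_ it n + (1 - a_ P) * gamma * tau_ it n.

(* [rho gamma P it n] is rho_(n+1). *)
Definition rho (R : realType) (q p : nat) (gamma : R) (P : parameters R)
    (it : iterates R q p) (n : nat) : R :=
  (psi_ P - vphi_ P) / (psi_ P + gamma * vphi_ P * tau_ it n).

(* [xmd P it n] and [ymd P it n] are x_(n+1)^md and y_(n+1)^md. *)
Definition xmd (R : realType) (q p : nat) (P : parameters R)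
    (it : iterates R q p) (n : nat) : 'rV[R]_q :=
  a_ P *: x_ it n + (1 - a_ P) *: z_ it n.+1.

Definition ymd (R : realType) (q p : nat) (P : parameters R)
    (it : iterates R q p) (n : nat) : 'rV[R]_p :=
  b_ P *: y_ it n + (1 - b_ P) *: zb_ it n.+1.

(* [trial D P it n t y]: y is the dual point computed from the trial step t in
   iteration n+1; [accept gamma D P it n t y] is the linesearch inequality of
   iteration n+1 for (t, y) in place of (tau_(n+1), y_(n+1)). *)
Definition trial (R : realType) (q p : nat) (D : problem R q p)
    (P : parameters R) (it : iterates R q p) (n : nat) (t : R)
    (y : 'rV[R]_p) : Prop :=
  prox (beta_ it n.+1 * t) (conjugate (pf D))
    (ymd P it n + (beta_ it n.+1 * t) *: grady_Phi D (x_ it n.+1) (y_ it n)) y.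

Definition accept (R : realType) (q p : nat) (gamma : R) (D : problem R q p)
    (P : parameters R) (it : iterates R q p) (n : nat) (t : R)
    (y : 'rV[R]_p) : Prop :=
  let theta := gradx_Phi D (x_ it n.+1) y - gradx_Phi D (x_ it n) (y_ it n) in
  t * tau_ it n / ((1 - a_ P) * xi_ P) * enorm theta ^+ 2 <=
    kappa gamma P it n * beta_ it n / beta_ it n.+1
      * enorm (x_ it n.+1 - x_ it n) ^+ 2
    + b_ P / beta_ it n.+1 * enorm (y - y_ it n) ^+ 2
    + 1 / beta_ it n.+1 * (1 - b_ P) * (1 + b_ P)
      * enorm (y - zb_ it n.+1) ^+ 2.

(* The step relations are those of iteration n+1, for all n >= 0.  The last
   conjunct of [alg_tau] says that all the trial steps preceding the accepted one
   were computed and rejected. *)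
Record aNPDAL_n (R : realType) (q p : nat) (D : problem R q p) (gamma : R)
    (P : parameters R) (it : iterates R q p) : Prop := {
  alg_x0 : edom (pg D) (x_ it 0);
  alg_y0 : edom (conjugate (pf D)) (y_ it 0);
  alg_z0 : z_ it 0 = x_ it 0;
  alg_zb0 : zb_ it 0 = y_ it 0;
  alg_beta0 : beta_ it 0 = beta0_ P;
  alg_delta0 : delta_ it 0 = delta0_ P;
  alg_tau0 : tau_ it 0 = tau0_ P;
  alg_beta : forall n,
    beta_ it n.+1 = (1 + gamma * rho gamma P it n * tau_ it n) * beta_ it n;
  alg_z : forall n,
    z_ it n.+1 = ((psi_ P - 1) / psi_ P) *: x_ it n + (1 / psi_ P) *: z_ it n;
  alg_x : forall n,
    prox (tau_ it n) (pg D)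
      (xmd P it n - tau_ it n *: gradx_Phi D (x_ it n) (y_ it n)) (x_ it n.+1);
  alg_zb : forall n,
    zb_ it n.+1 = (1 - b_ P) *: y_ it n + b_ P *: zb_ it n;
  alg_tau : forall n,
    let step i := Num.min (vphi_ P * tau_ it n) (taumax_ P) * mu_ P ^+ i in
    exists i : nat,
      [/\ tau_ it n.+1 = step i,
          trial D P it n (step i) (y_ it n.+1),
          accept gamma D P it n (step i) (y_ it n.+1)
        & forall j, (j < i)%N ->
            exists2 y, trial D P it n (step j) y
              & ~ accept gamma D P it n (step j) y];
  alg_delta : forall n, delta_ it n.+1 = tau_ it n.+1 / tau_ it n }.

Definition sN (R : realType) (q p : nat) (it : iterates R q p) (N : nat) : R :=
  \sum_(1 <= n < N.+1) beta_ it n * tau_ it n.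

Definition xhat (R : realType) (q p : nat) (it : iterates R q p) (N : nat) :
    'rV[R]_q :=
  (1 / sN it N) *: \sum_(1 <= n < N.+1) (beta_ it n * tau_ it n) *: x_ it n.

Definition yhat (R : realType) (q p : nat) (it : iterates R q p) (N : nat) :
    'rV[R]_p :=
  (1 / sN it N) *: \sum_(1 <= n < N.+1) (beta_ it n * tau_ it n) *: y_ it n.

Definition gap (R : realType) (q p : nat) (D : problem R q p)
    (xs : 'rV[R]_q) (ys : 'rV[R]_p) (x : 'rV[R]_q) (y : 'rV[R]_p) : \bar R :=
  (Lagr D x ys - Lagr D xs y)%E.

Definition A1 (R : realType) (q p : nat) (gamma : R) (P : parameters R)
    (it : iterates R q p) (xs : 'rV[R]_q) (ys : 'rV[R]_p) : R :=
  a_ P * enorm (x_ it 1 - xs) ^+ 2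
  + ((1 - a_ P) * psi_ P + (1 - a_ P) * gamma * tau_ it 1) / (psi_ P - 1)
    * enorm (z_ it 2 - xs) ^+ 2
  + (a_ P + kappa gamma P it 0 * beta_ it 0 / beta_ it 1)
    * enorm (x_ it 1 - x_ it 0) ^+ 2
  + b_ P / beta_ it 1 * enorm (y_ it 0 - ys) ^+ 2
  + 1 / beta_ it 1 * enorm (zb_ it 1 - ys) ^+ 2.

(* Main.v *)
Require Import Defs.
From mathcomp Require Import all_boot all_order all_algebra.
From mathcomp Require Import all_classical all_reals all_analysis.
From mathcomp Require Import ring lra.

(* Adding the proximal inequalities of two consecutive primal steps and of the
   dual step, and using the linesearch inequality, gives a Lyapunov inequality
     beta_(n+1) E_(n+1) + 2 beta_n tau_n J(x_n, y_n) <= beta_n E_n,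
   where the growth factor of beta is paid for by the strong convexity of g.
   Summation and convexity bound beta_n |x_n - x*|^2 and s_N J(hat x_N, hat y_N).

   It remains to show beta_n >= c n^2: then s_N >= c' N^2 follows as well, since
   beta_(n+1) - beta_n <= gamma beta_n tau_n.  A rejected trial step and the local
   Lipschitz bound show that a step either grows by the factor vphi, or satisfies
   tau_n sqrt(beta_n) >= k, or tau_n tau_(n-1) beta_n >= k.  The last alternative
   does not bound tau_n sqrt(beta_n) from below, but when tau_(n-1) is large the
   preceding increase of sqrt(beta) compensates for the drop, and sqrt(beta_n)
   still grows linearly. *)

Set Implicit Arguments.
Unset Strict Implicit.
Unset Printing Implicit Defensive.

Import Order.TTheory GRing.Theory Num.Theory.
Import numFieldNormedType.Exports.

Local Open Scope classical_set_scope.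
Local Open Scope ring_scope.

(** * Euclidean inner product and norm on row vectors *)

Section euclidean.
Context {R : realType} {n : nat}.
Implicit Types (u v w : 'rV[R]_n) (c t : R).

Lemma dotvC u v : dotv u v = dotv v u.
Proof. by apply: eq_bigr => i _; rewrite mulrC. Qed.

Lemma dotvDl u v w : dotv (u + v) w = dotv u w + dotv v w.
Proof. by rewrite -big_split; apply: eq_bigr => i _; rewrite mxE mulrDl. Qed.

Lemma dotvZl c u v : dotv (c *: u) v = c * dotv u v.
Proof. by rewrite mulr_sumr; apply: eq_bigr => i _; rewrite mxE mulrA. Qed.

Lemma dotvNl u v : dotv (- u) v = - dotv u v.
Proof. by rewrite -scaleN1r dotvZl mulN1r. Qed.

Lemma dotvDr u v w : dotv w (u + v) = dotv w u + dotv w v.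
Proof. by rewrite dotvC dotvDl !(dotvC w). Qed.

Lemma dotvZr c u v : dotv v (c *: u) = c * dotv v u.
Proof. by rewrite dotvC dotvZl dotvC. Qed.

Lemma dotvNr u v : dotv v (- u) = - dotv v u.
Proof. by rewrite dotvC dotvNl dotvC. Qed.

Definition dotvE := (dotvDl, dotvDr, dotvZl, dotvZr, dotvNl, dotvNr).

Lemma dotv_ge0 u : 0 <= dotv u u.
Proof. by apply: sumr_ge0 => i _; rewrite -expr2 sqr_ge0. Qed.

Lemma enorm_ge0 u : 0 <= enorm u.
Proof. exact: sqrtr_ge0. Qed.

Lemma sqr_enorm u : enorm u ^+ 2 = dotv u u.
Proof. by rewrite sqr_sqrtr ?dotv_ge0. Qed.

Lemma enormZ c u : enorm (c *: u) = `|c| * enorm u.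
Proof.
by rewrite /enorm !dotvE mulrA -expr2 sqrtrM ?sqr_ge0// sqrtr_sqr.
Qed.

Lemma enorm0 : enorm (0 : 'rV[R]_n) = 0.
Proof. by rewrite -[X in enorm X](scale0r 0) enormZ normr0 mul0r. Qed.

Lemma enormN u : enorm (- u) = enorm u.
Proof. by rewrite /enorm !dotvE opprK. Qed.

Lemma enormB u v : enorm (u - v) = enorm (v - u).
Proof. by rewrite -enormN opprB. Qed.

Lemma dotv_young c u v :
  0 < c -> 2 * dotv u v <= c * enorm u ^+ 2 + c^-1 * enorm v ^+ 2.
Proof.
move=> c0; have := dotv_ge0 (c *: u - v).
rewrite !dotvE !sqr_enorm (dotvC v u) => h.
rewrite -(ler_pM2l c0) -subr_ge0 (le_trans h)// le_eqVlt; apply/orP; left.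
by apply/eqP; field; rewrite gt_eqF.
Qed.

Lemma dotv_eq0 u : dotv u u = 0 -> u = 0.
Proof.
move=> u0; apply/rowP => i; rewrite mxE; apply/eqP.
rewrite -sqrf_eq0 expr2; apply/eqP; move: i (erefl true).
by apply: psumr_eq0P u0 => i _; rewrite -expr2 sqr_ge0.
Qed.

Lemma dotv_le_enorm u v : dotv u v <= enorm u * enorm v.
Proof.
have [v0|v0] := eqVneq (dotv v v) 0.
  rewrite (dotv_eq0 v0) -(scale0r (0 : 'rV[R]_n)) dotvZr mul0r.
  by rewrite mulr_ge0 ?enorm_ge0.
have vp : 0 < dotv v v by rewrite lt_neqAle eq_sym v0 dotv_ge0.
rewrite (le_trans (ler_norm _))// -(@ler_pXn2r _ 2) ?nnegrE//; last first.
  by rewrite mulr_ge0 ?enorm_ge0.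
rewrite real_normK ?num_real// exprMn !sqr_enorm -subr_ge0 -(pmulr_rge0 _ vp).
have := dotv_ge0 (dotv v v *: u - dotv u v *: v).
rewrite !dotvE (dotvC v u); congr (0 <= _); ring.
Qed.

Lemma enormD u v : enorm (u + v) <= enorm u + enorm v.
Proof.
rewrite -(@ler_pXn2r _ 2) ?nnegrE ?addr_ge0 ?enorm_ge0//.
have := dotv_le_enorm u v.
rewrite sqrrD !sqr_enorm !dotvE (dotvC v u) => h; lra.
Qed.

Lemma norm_le_enorm u : `|u| <= enorm u.
Proof.
rewrite /Num.Def.normr/= mx_normrE; apply: bigmax_le; first exact: enorm_ge0.
move=> [i j] _ /=; rewrite ord1 -sqrtr_sqr ler_wsqrtr//.
rewrite /dotv (bigD1 j)//= -expr2 lerDl.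
by apply: sumr_ge0 => k _; rewrite -expr2 sqr_ge0.
Qed.

Lemma three_point u v w : 2 * dotv (u - v) (w - u)
  = enorm (v - w) ^+ 2 - enorm (u - v) ^+ 2 - enorm (u - w) ^+ 2.
Proof.
by rewrite !sqr_enorm !dotvE (dotvC v u) (dotvC w u) (dotvC w v); ring.
Qed.

Lemma sqr_enorm_conv t u v w : enorm (t *: u + (1 - t) *: v - w) ^+ 2
  = t * enorm (u - w) ^+ 2 + (1 - t) * enorm (v - w) ^+ 2
    - t * (1 - t) * enorm (u - v) ^+ 2.
Proof.
by rewrite !sqr_enorm !dotvE (dotvC v u) (dotvC w u) (dotvC w v); ring.
Qed.

(** The local Lipschitz assumption speaks of [bounded_set], which refers to the sup norm, whereas
    the estimates produce Euclidean balls; the Euclidean norm dominates the sup norm. *)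
Lemma bounded_set_enorm (A : set 'rV[R]_n) w c :
  (forall u, A u -> enorm (u - w) <= c) -> bounded_set A.
Proof.
move=> Ac; exists (c + enorm w); split; first exact: num_real.
move=> M cM u /Ac uc; apply: le_trans (ltW cM).
rewrite (le_trans (norm_le_enorm u))// -[u in enorm u](subrK w).
by rewrite (le_trans (enormD _ _))// lerD2r.
Qed.

End euclidean.

(** * Gradients and the first-order inequality for convex functions *)

Section gradient.
Context {R : realType} {n : nat}.
Implicit Types (phi : 'rV[R]_n -> R) (x u v : 'rV[R]_n).

Lemma derive_grad phi x v :
  differentiable phi x -> 'D_v phi x = dotv (grad phi x) v.
Proof.
move=> dphi; rewrite deriveE// [in LHS](row_sum_delta v) linear_sum.
by apply: eq_bigr => i _; rewrite linearZ/= mxE deriveE// mulrC.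
Qed.

Lemma convex_grad_le phi x u : differentiable phi x ->
  (forall t, 0 < t -> t < 1 ->
    phi (t *: u + (1 - t) *: x) <= t * phi u + (1 - t) * phi x) ->
  dotv (grad phi x) (u - x) <= phi u - phi x.
Proof.
move=> dphi cphi; rewrite -derive_grad//.
have dv : derivable phi x (u - x) by exact: diff_derivable.
(* Convexity controls the difference quotient only for [0 < t < 1], so the two-sided limit is
   replaced by the right-hand one. *)
rewrite /derive cvg_at_rightE//; apply: limr_le.
  by apply/cvg_ex; eexists; apply: cvg_dnbhs_at_right; exact: dv.
near=> t.
have t0 : 0 < t by near: t; exact: nbhs_right_gt.
have t1 : t < 1 by near: t; exact: nbhs_right_lt.
rewrite /= /GRing.scale/= mulrC ler_pdivrMr// lerBlDr.
have -> : t *: (u - x) + x = t *: u + (1 - t) *: x.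
  by rewrite scalerBr scalerBl scale1r addrAC addrA.
by rewrite (le_trans (cphi _ t0 t1))// le_eqVlt; apply/orP; left; apply/eqP; ring.
Unshelve. all: by end_near. Qed.

Lemma dotv_delta (u : 'rV[R]_n) i : dotv u (delta_mx 0 i) = u 0 i.
Proof.
rewrite /dotv (bigD1 i)//= mxE !eqxx mulr1 big1 ?addr0// => j ji.
by rewrite mxE (negbTE ji) andbF mulr0.
Qed.

Lemma grad_affine (c : R) (w x : 'rV[R]_n) : grad (fun v => c + dotv w v) x = w.
Proof.
apply/rowP => i; rewrite mxE; apply: cvg_lim => //.
apply: (@cvg_trans _ (cst (w 0 i) @ 0^')); last exact: cvg_cst.
apply: near_eq_cvg; near=> h; rewrite /= !dotvE dotv_delta.
have h0 : h != 0 by near: h; exact: nbhs_dnbhs_neq.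
by rewrite /GRing.scale/=; field.
Unshelve. all: by end_near. Qed.

End gradient.

(** * Derivatives of the coupling term *)

Section differentiability.
Context {R : realType} {q p : nat} (D : problem R q p).

Lemma differentiable_dotl (F : 'rV[R]_q -> 'rV[R]_p) (y : 'rV[R]_p) x :
  differentiable F x -> differentiable (fun u => dotv (F u) y) x.
Proof.
move=> dF.
have -> : (fun u => dotv (F u) y) = \sum_(i < p) (fun u => F u 0 i * y 0 i).
  by apply/funext => u; rewrite fct_sumE.
apply: differentiable_sum => i.
apply: differentiableM => //.
apply: (@differentiable_comp _ _ _ _ F (fun v : 'rV_p => v 0 i)) => //.
exact: differentiable_coord.
Qed.

Lemma grady_PhiE x y : grady_Phi D x y = pH D x.
Proof. exact: grad_affine. Qed.

End differentiability.

(* Unlike [convex_function], this also asserts that the domain is convex. *)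
Definition convex_on (R : realType) (n : nat) (A : set 'rV[R]_n)
    (phi : 'rV[R]_n -> R) : Prop :=
  forall x y t, A x -> A y -> 0 < t -> t < 1 ->
    A (t *: x + (1 - t) *: y) /\
    phi (t *: x + (1 - t) *: y) <= t * phi x + (1 - t) * phi y.

(** * Convexity, proximal points and conjugates *)

Section convexity.
Context {R : realType} {n : nat}.
Implicit Types (phi : 'rV[R]_n -> \bar R) (f : 'rV[R]_n -> R) (A : set 'rV[R]_n).

Lemma convex_function_ineq A f x y t : convex_function A f ->
  A x -> A y -> 0 < t -> t < 1 ->
  f (t *: x + (1 - t) *: y) <= t * f x + (1 - t) * f y.
Proof.
move=> cf Ax Ay t0 t1.
exact: (cf (Itv01 (ltW t0) (ltW t1)) x y (mem_set Ax) (mem_set Ay)).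
Qed.

Lemma convex_onD A f1 f2 : convex_on A f1 -> convex_on A f2 ->
  convex_on A (fun x => f1 x + f2 x).
Proof.
move=> c1 c2 x y t Ax Ay t0 t1; have [Axy h1] := c1 x y t Ax Ay t0 t1.
have [_ h2] := c2 x y t Ax Ay t0 t1; split=> //.
by rewrite !mulrDr [leRHS]addrACA lerD.
Qed.

(** Jensen's inequality by induction: the new mean is a convex combination of the old mean and the
    new point. The sums start at 1, as in [sN]. *)
Lemma convex_on_mean A f (w : nat -> R) (x : nat -> 'rV[R]_n) N :
  convex_on A f -> (forall k, 0 < w k.+1) -> (forall k, A (x k.+1)) ->
  (1 <= N)%N ->
  let s := \sum_(1 <= k < N.+1) w k in
  let m := (1 / s) *: \sum_(1 <= k < N.+1) w k *: x k in
  A m /\ s * f m <= \sum_(1 <= k < N.+1) w k * f (x k).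
Proof.
move=> cf w0 Ax; elim: N => [//|[|N] IH] _ /=.
  by rewrite !big_nat1 scalerA div1r mulVf ?gt_eqF// scale1r.
move: (IH isT) => /=; rewrite !(big_nat_recr N.+2)//=.
have : 0 < \sum_(1 <= k < N.+2) w k.
  rewrite big_nat_recr//= ltr_wpDl// big_add1 sumr_ge0// => i _; exact: ltW.
move: (\sum_(1 <= k < N.+2) w k) => s s0.
move: (\sum_(1 <= k < N.+2) w k *: x k) => X.
move: (\sum_(1 <= k < N.+2) w k * f (x k)) => F [AX FX].
have S0 : 0 < s + w N.+2 by rewrite addr_gt0.
have t0 : 0 < s / (s + w N.+2) by rewrite divr_gt0.
have t1 : s / (s + w N.+2) < 1 by rewrite ltr_pdivrMr// mul1r ltrDl.
have [] := cf _ (x N.+2) _ AX (Ax _) t0 t1.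
have et : 1 - s / (s + w N.+2) = w N.+2 / (s + w N.+2).
  by field; rewrite gt_eqF.
rewrite et [X in A (X + _)]scalerA [X in f (X + _)]scalerA.
have -> : s / (s + w N.+2) * (1 / s) = 1 / (s + w N.+2).
  by field; rewrite !gt_eqF.
have -> : w N.+2 / (s + w N.+2) = 1 / (s + w N.+2) * w N.+2 by field; rewrite gt_eqF.
rewrite -(scalerA (1 / (s + w N.+2)) (w N.+2)) -scalerDr => AY fY; split => //.
rewrite -ler_pdivlMl// (le_trans fY)//.
have -> : s / (s + w N.+2) * f ((1 / s) *: X) +
    1 / (s + w N.+2) * w N.+2 * f (x N.+2)
  = (s + w N.+2)^-1 * (s * f ((1 / s) *: X) + w N.+2 * f (x N.+2)).
  by field; rewrite gt_eqF.
by apply: ler_wpM2l; [rewrite invr_ge0 ltW|rewrite lerD2r].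
Qed.

Lemma fin_num_edom phi x : (-oo < phi x)%E -> edom phi x -> phi x \is a fin_num.
Proof. by move=> h1 h2; rewrite fin_numElt h1. Qed.

Lemma econvex_fine phi : (forall x, (-oo < phi x)%E) -> econvex phi ->
  convex_on (edom phi) (fun x => fine (phi x)).
Proof.
move=> phi_gt cphi x y t /(fin_num_edom (phi_gt x)) fx.
move=> /(fin_num_edom (phi_gt y)) fy t0 t1.
have := cphi x y t t0 t1; rewrite -(fineK fx) -(fineK fy) -!EFinM -EFinD.
move=> h; have xy_dom : edom phi (t *: x + (1 - t) *: y).
  by rewrite /edom/= (le_lt_trans h)// ltry.
by split=> //; rewrite -lee_fin (fineK (fin_num_edom (phi_gt _) xy_dom)).
Qed.

(** Fermat's rule for the proximal problem: [u] is compared with the points of the segment from [u]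
    to [v], convexity bounds [phi] there, and division by the parameter [t] followed by [t -> 0]
    leaves the subgradient inequality. *)
Lemma prox_subdifferential phi l x u : Defs.proper phi -> econvex phi -> 0 < l ->
  prox l phi x u -> edom phi u /\ subdifferential phi u (l^-1 *: (x - u)).
Proof.
move=> [phi_gt [w wdom]] cphi l0 xu.
have udom : edom phi u.
  have := xu w; rewrite -(fineK (fin_num_edom (phi_gt w) wdom)) -EFinD.
  by rewrite /edom/=; case: (phi u) => [r|//|//] _; rewrite ltry.
split=> // v; have fu := fin_num_edom (phi_gt u) udom.
have [vdom|] := boolP (phi v < +oo)%E; last by rewrite -leNgt leye_eq => /eqP ->; rewrite leey.
have fv := fin_num_edom (phi_gt v) vdom.
suff h t : 0 < t -> t < 1 -> 2 * l * (fine (phi u) - fine (phi v)) <=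
    enorm (x - v) ^+ 2 - enorm (u - x) ^+ 2 - enorm (u - v) ^+ 2
    + t * enorm (u - v) ^+ 2.
  rewrite -(fineK fu) -(fineK fv) -EFinD lee_fin dotvZl -opprB dotvNl.
  rewrite mulrN -lerBrDr opprK addrC -lerBlDr ler_pdivlMl//.
  rewrite -(ler_pM2l (ltr0n R 2)) mulrA three_point.
  set d := enorm (u - v) ^+ 2 in h *; have d0 : 0 <= d by exact: sqr_ge0.
  apply/ler_addgt0Pr => e e0.
  (* The limit is taken with [t = e / (d + 2 * e)]: then [t * d <= e], and the summand [2 * e] keeps
     [t] below 1 and the divisor positive when [d = 0]. *)
  have p : 0 < d + 2 * e by lra.
  have h1 : 0 < e / (d + 2 * e) by rewrite divr_gt0.
  have h2 : e / (d + 2 * e) < 1 by rewrite ltr_pdivrMr// mul1r; lra.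
  rewrite (le_trans (h _ h1 h2))// lerD2l mulrAC ler_pdivrMr// ler_pM2l//; lra.
move=> t0 t1; have [_] := econvex_fine phi_gt cphi vdom udom t0 t1.
have [tdom _] := econvex_fine phi_gt cphi vdom udom t0 t1.
have := xu (t *: v + (1 - t) *: u).
rewrite -(fineK fu) -(fineK (fin_num_edom (phi_gt _) tdom)) -!EFinD lee_fin. rewrite /=.
rewrite sqr_enorm_conv (enormB v x) (enormB v u).
move: (fine (phi _)) (fine (phi u)) (fine (phi v)) => a b c h1 h2.
have := le_trans h1 (lerD h2 (lexx _)).
rewrite div1r -(ler_pM2l (mulr_gt0 (ltr0n R 2) l0)) !mulrDr !mulVKf ?gt_eqF ?mulr_gt0//.
move=> /= h; rewrite -(ler_pM2l t0); lra.
Qed.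

Lemma conjugate_gtNy phi y : edom phi !=set0 -> (-oo < conjugate phi y)%E.
Proof.
move=> [x xdom]; apply: (@lt_le_trans _ _ ((dotv x y)%:E - phi x)%E).
  by move: xdom; rewrite /edom/=; case: (phi x) => [r|//|]  _; rewrite ?ltNyr.
by apply: ereal_sup_ubound; exists x.
Qed.

Lemma econvex_conjugate phi : (forall x, (-oo < phi x)%E) ->
  econvex (conjugate phi).
Proof.
move=> phi_gt y z t t0 t1; apply: ub_ereal_sup => _ [x _ <-].
have t1' : 0 <= 1 - t by rewrite subr_ge0 ltW.
have hy : ((dotv x y)%:E - phi x <= conjugate phi y)%E.
  by apply: ereal_sup_ubound; exists x.
have hz : ((dotv x z)%:E - phi x <= conjugate phi z)%E.
  by apply: ereal_sup_ubound; exists x.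
apply: (@le_trans _ _ (t%:E * ((dotv x y)%:E - phi x)
    + (1 - t)%:E * ((dotv x z)%:E - phi x))%E); last first.
  by apply: leeD; apply: lee_wpmul2l => //; rewrite lee_fin ltW.
move: (phi_gt x); case: (phi x) => [r _| |//]; last by rewrite /= !addeNy leNye.
rewrite lee_fin !dotvE.
by rewrite le_eqVlt; apply/orP; left; apply/eqP; ring.
Qed.

End convexity.

(** * A scalar recursion that forces linear growth *)

Section scalar_growth.
Context {R : realType}.

(* The potential [alpha * s n - (r n)^-1] increases by at least 1 at each step:
   when [r] is large, [s] gains a multiple of [r], which pays for a later drop
   of [r] to the order of [1 / r]; when [r] is small, [(r n)^-1] decreases
   geometrically. *)
Lemma linear_growth (s r : nat -> R) (c k K : R) :
  0 < c -> 1 < k -> 0 <= K -> 0 < s 0%N -> (forall n, 0 < r n) ->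
  (forall n, s n + c * r n <= s n.+1) ->
  (forall n, (r n.+1)^-1 <= (r n)^-1 / k + K * (1 + r n)) ->
  exists2 C : R, 0 < C & forall n, C * n.+1%:R <= s n.
Proof.
move=> c0 k1 K0 s0 r0 hs hr.
have k0 : 0 < 1 - k^-1 by rewrite subr_gt0 invf_lt1// (lt_trans ltr01).
pose l := 1 - k^-1; have l0 : 0 < l by [].
have kV : k^-1 = 1 - l by rewrite subKr.
clearbody l.
(* [A] ensures [A * r + l / r >= K + 1] for all [r > 0], by completing the square. In [alpha], the
   first summand gives [alpha * c >= K + A] and the second makes the initial potential at least
   1. *)
pose A := (K + 1) ^+ 2 / l.
pose alpha := (K + A) / c + (1 + (r 0%N)^-1) / s 0%N.
have A0 : 0 < A by rewrite divr_gt0// exprn_gt0// ltr_wpDl.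
have rV n : 0 < (r n)^-1 by rewrite invr_gt0.
have alpha1 : 0 < (1 + (r 0%N)^-1) / s 0%N by rewrite divr_gt0// addr_gt0.
have alpha2 : 0 < (K + A) / c by rewrite divr_gt0// ltr_wpDl.
have alpha0 : 0 < alpha by rewrite addr_gt0.
have step n : alpha * s n - (r n)^-1 + 1 <= alpha * s n.+1 - (r n.+1)^-1.
  have h1 : alpha * (s n + c * r n) <= alpha * s n.+1 by rewrite ler_pM2l.
  have h2 : (K + A) * r n <= alpha * c * r n.
    rewrite ler_pM2r// /alpha mulrDl divfK ?gt_eqF// lerDl mulr_ge0 ?ltW//.
  have h3 : K + 1 <= A * r n + l * (r n)^-1.
    rewrite -subr_ge0.
    have -> : A * r n + l * (r n)^-1 - (K + 1) =
       (((K + 1) * r n - l / 2) ^+ 2 + 3 / 4 * l ^+ 2) / (l * r n).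
      by rewrite /A; field; rewrite !gt_eqF ?r0.
    apply: divr_ge0; last by rewrite ltW// mulr_gt0.
    by rewrite addr_ge0 ?sqr_ge0// mulr_ge0 ?sqr_ge0// divr_ge0.
  have h4 := hr n; rewrite kV in h4.
  nra.
have main n : n.+1%:R <= alpha * s n - (r n)^-1.
  elim: n => [|n IH]; last by rewrite -natr1 (le_trans _ (step n))// lerD2r.
  rewrite /alpha mulrDl divfK ?gt_eqF//.
  have : 0 <= (K + A) / c * s 0%N by rewrite mulr_ge0 ?ltW.
  lra.
exists alpha^-1; first by rewrite invr_gt0.
by move=> n; rewrite ler_pdivrMl// (le_trans (main n))// gerBl ltW.
Qed.

End scalar_growth.

(** * Algebraic estimates for one primal and one dual step *)

Section one_step.
Context {R : realType} {n : nat}.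

(* The indefinite part is [2 psi delta <x' - x, x' - z>]; it is absorbed by
   Young's inequality exactly when [delta <= vphi], which is where the term
   [psi ^+ 3 * vphi / (1 + psi)] of [omega1] comes from. *)
Lemma primal_one_step (psi a xi vphi xi1 g delta omega : R)
    (xp x x' zp z z' w : 'rV[R]_n) :
  1 < psi -> 0 < a < 1 -> 0 < vphi -> 0 < xi1 < 1 / vphi -> 0 <= g ->
  0 < delta <= vphi ->
  z = ((psi - 1) / psi) *: x + (1 / psi) *: zp ->
  z' = ((psi - 1) / psi) *: x' + (1 / psi) *: z ->
  omega = (1 - a) * (2 * psi - xi - psi ^+ 3 * vphi / (1 + psi)) - a / xi1 ->
  2 * dotv (x' - (a *: x + (1 - a) *: z)) (w - x')
  + delta * (2 * dotv (x - (a *: xp + (1 - a) *: zp)) (x' - x))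
  - g * (enorm (w - x') ^+ 2 + enorm (x' - x) ^+ 2)
  + (1 - a) * xi * delta * enorm (x' - x) ^+ 2 <=
  a * enorm (x - w) ^+ 2
  + ((1 - a) * psi + (1 - a) * g) / (psi - 1) * enorm (z - w) ^+ 2
  + a * enorm (x - xp) ^+ 2
  - a * (1 + g) * enorm (x' - w) ^+ 2
  - (1 - a) * (1 + g) * psi / (psi - 1) * enorm (z' - w) ^+ 2
  - (a + omega * delta + g) * enorm (x' - x) ^+ 2.
Proof.
move=> psi1 /andP[a0 a1] vphi0 /andP[xi10 xi1v] g0 /andP[d0 dv] zE z'E ->.
have psi0 : 0 < psi by rewrite (lt_trans _ psi1).
(* Solving the averaging recursion backwards gives [x - zp = psi *: (x - z)], which eliminates
   [zp]. *)
have zpE : zp = psi *: z - (psi - 1) *: x.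
  rewrite zE scalerDr !scalerA mulrCA divff ?gt_eqF// mulr1 mulrCA divff ?gt_eqF//.
  by rewrite mul1r scale1r addrAC subrr add0r.
have P1 := three_point x' x w.
have P2 := three_point x' z w.
have P3 : enorm (z' - w) ^+ 2 = (psi - 1) / psi * enorm (x' - w) ^+ 2
    + 1 / psi * enorm (z - w) ^+ 2 - (psi - 1) / psi ^+ 2 * enorm (x' - z) ^+ 2.
  have t1 : 1 / psi = 1 - (psi - 1) / psi by field; rewrite gt_eqF.
  by rewrite z'E t1 sqr_enorm_conv; field; rewrite gt_eqF.
have P4 := three_point x z x'.
(* Young's inequality with constant [xi1]; as [delta * xi1 <= vphi * xi1 < 1], the coefficient of
   [|x - xp|^2] is at most 1. *)
have P5 : delta * (2 * dotv (x - xp) (x' - x)) <=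
    enorm (x - xp) ^+ 2 + delta / xi1 * enorm (x' - x) ^+ 2.
  have := dotv_young (x - xp) (x' - x) xi10.
  rewrite -(ler_pM2l d0) => /le_trans; apply.
  rewrite mulrDr (mulrA delta xi1) (mulrA delta xi1^-1) lerD2r ler_piMl ?sqr_ge0//.
  by rewrite (le_trans (ler_wpM2r (ltW xi10) dv))// mulrC -ler_pdivlMr// ltW.
(* The budget [1 + 1 / psi] for [|x' - z|^2] has two sources: 1 from the three-point identity [P2]
   and [1 / psi] from the averaging identity [P3]. The Young constant below exhausts it exactly at
   [delta = vphi]. *)
have P6 : psi * delta * (enorm (x' - z) ^+ 2 - enorm (x - z) ^+ 2
      + enorm (x' - x) ^+ 2) <=
    delta * psi ^+ 3 * vphi / (1 + psi) * enorm (x' - x) ^+ 2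
    + (1 + 1 / psi) * enorm (x' - z) ^+ 2.
  have c0 : 0 < psi ^+ 2 * vphi / (1 + psi).
    by rewrite divr_gt0 ?addr_gt0 ?mulr_gt0 ?exprn_gt0.
  have := dotv_young (x' - x) (x' - z) c0.
  rewrite -(ler_pM2l (mulr_gt0 psi0 d0)) => h.
  have -> : enorm (x' - z) ^+ 2 - enorm (x - z) ^+ 2 + enorm (x' - x) ^+ 2
      = 2 * dotv (x' - x) (x' - z).
    by rewrite !sqr_enorm !dotvE (dotvC z x') (dotvC z x) (dotvC x x'); ring.
  rewrite (le_trans h)// mulrDr (mulrA _ (_ / _)) (mulrA _ (_^-1)) lerD//.
    by rewrite le_eqVlt; apply/orP; left; apply/eqP; field; rewrite gt_eqF// addr_gt0.
  rewrite ler_wpM2r ?sqr_ge0//.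
  have -> : psi * delta * (psi ^+ 2 * vphi / (1 + psi))^-1
    = delta / vphi * (1 + 1 / psi).
    by field; rewrite !gt_eqF// addr_gt0.
  apply: ler_piMl; last by rewrite ler_pdivrMr// mul1r.
  by rewrite addr_ge0// divr_ge0// ltW.
have e1 : 2 * dotv (x' - (a *: x + (1 - a) *: z)) (w - x')
    = a * (2 * dotv (x' - x) (w - x')) + (1 - a) * (2 * dotv (x' - z) (w - x')).
  by rewrite !dotvE; ring.
have e2 : 2 * dotv (x - (a *: xp + (1 - a) *: zp)) (x' - x)
    = a * (2 * dotv (x - xp) (x' - x))
      + (1 - a) * psi * (2 * dotv (x - z) (x' - x)).
  by rewrite zpE !dotvE; ring.
rewrite e1 e2 P1 P2 P3 P4 (enormB z x') (enormB x x') (enormB w x').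
rewrite -subr_ge0 in P5; rewrite -subr_ge0 in P6.
have a1' : 0 <= 1 - a by rewrite subr_ge0 ltW.
have P7 : 0 <= (1 - a) * (g / psi * enorm (x' - z) ^+ 2).
  by rewrite mulr_ge0// mulr_ge0 ?sqr_ge0// divr_ge0// ltW.
(* The slack of the claim is exactly [a] times that of [P5], plus [1 - a] times that of [P6], plus
   the term of [P7]. *)
rewrite -subr_ge0.
have := addr_ge0 (addr_ge0 (mulr_ge0 (ltW a0) P5) (mulr_ge0 a1' P6)) P7.
congr (0 <= _). field.
by rewrite !gt_eqF ?subr_gt0 ?addr_gt0.
Qed.

(** The three-point identity is applied with [yp] and with [zb]; the recursion for [zb'] then trades
    [(1 - b) |y - v|^2] for [|zb' - v|^2], so that the squared distances to [v] can telescope. *)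
Lemma dual_one_step (b : R) (yp y zb zb' v : 'rV[R]_n) :
  zb' = (1 - b) *: y + b *: zb ->
  2 * dotv (y - (b *: yp + (1 - b) *: zb)) (v - y) =
  b * enorm (yp - v) ^+ 2 + enorm (zb - v) ^+ 2
  - b * enorm (y - v) ^+ 2 - enorm (zb' - v) ^+ 2
  - b * enorm (y - yp) ^+ 2 - (1 - b) * (1 + b) * enorm (y - zb) ^+ 2.
Proof.
move=> zbE; have {}zbE : zb' = (1 - b) *: y + (1 - (1 - b)) *: zb by rewrite subKr.
rewrite zbE sqr_enorm_conv subKr.
have e : dotv (y - (b *: yp + (1 - b) *: zb)) (v - y)
    = b * dotv (y - yp) (v - y) + (1 - b) * dotv (y - zb) (v - y).
  by rewrite !dotvE; ring.
by rewrite e mulrDr !(mulrCA 2) !three_point; ring.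
Qed.

End one_step.

(** * Setting: admissible data, a saddle point and the iterates *)

Section algorithm.
Context {R : realType} {q p : nat}.
Variables (D : problem R q p) (gamma : R) (P : parameters R).
Variables (it : iterates R q p) (xs : 'rV[R]_q) (ys : 'rV[R]_p).
Hypothesis hD : admissible_strongly_convex D gamma.
Hypothesis hs : saddle_point D xs ys.
Hypothesis hP : valid_parameters P.
Hypothesis hS : aNPDAL_n D gamma P it.

Local Notation X := (x_ it).
Local Notation Y := (y_ it).
Local Notation Z := (z_ it).
Local Notation Zb := (zb_ it).
Local Notation beta := (beta_ it).
Local Notation tau := (tau_ it).
Local Notation delta := (delta_ it).
Local Notation psi := (psi_ P).
Local Notation a := (a_ P).
Local Notation b := (b_ P).
Local Notation xi := (xi_ P).
Local Notation vphi := (vphi_ P).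
Local Notation mu := (mu_ P).
Local Notation taumax := (taumax_ P).
Local Notation fc := (conjugate (pf D)).
Local Notation G u := (fine (pg D u)).
Local Notation F v := (fine (fc v)).

Let gamma0 : 0 < gamma := asc_gamma hD.
Let a0 : 0 < a. Proof. by case/andP: (vp_a hP). Qed.
Let a1 : 0 < 1 - a. Proof. by rewrite subr_gt0; case/andP: (vp_a hP). Qed.
Let b0 : 0 <= b. Proof. by case/andP: (vp_b hP). Qed.
Let b1 : 0 < 1 - b. Proof. by rewrite subr_gt0; case/andP: (vp_b hP). Qed.
Let xi0 : 0 < xi := vp_xi hP.
Let psi1 : 1 < psi. Proof. by case/andP: (vp_psi hP). Qed.
Let psi0 : 0 < psi. Proof. exact: lt_trans psi1. Qed.
Let vphi1 : 1 < vphi. Proof. by case/andP: (vp_vphi hP). Qed.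
Let vphi0 : 0 < vphi. Proof. exact: lt_trans vphi1. Qed.
Let vphi_psi : 0 < psi - vphi.
Proof. by rewrite subr_gt0; case/andP: (vp_vphi hP). Qed.
Let taumax0 : 0 < taumax := vp_taumax hP.
Let mu0 : 0 < mu. Proof. by case/andP: (vp_mu hP). Qed.
Let mu1 : mu <= 1. Proof. by apply: ltW; case/andP: (vp_mu hP). Qed.

Let g_gtNy u : (-oo < pg D u)%E.
Proof. by case: (sa_g (asc_standing hD)) => -[]. Qed.

Let g_proper : Defs.proper (pg D).
Proof. by case: (sa_g (asc_standing hD)). Qed.

Let g_convex : econvex (pg D).
Proof. by case: (sa_g (asc_standing hD)). Qed.

Let xs_dom : edom (pg D) xs. Proof. by case: hs. Qed.
Let ys_dom : edom fc ys. Proof. by case: hs. Qed.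

Let fc_gtNy v : (-oo < fc v)%E.
Proof. by apply: conjugate_gtNy; case: (sa_f (asc_standing hD)) => -[]. Qed.

Let fc_proper : Defs.proper fc.
Proof. by split; [exact: fc_gtNy|exists ys]. Qed.

Let fc_convex : econvex fc.
Proof. by apply: econvex_conjugate; case: (sa_f (asc_standing hD)) => -[]. Qed.

Lemma Lagr_fine u v : edom (pg D) u -> edom fc v ->
  Lagr D u v = (G u + Phi D u v - F v)%:E.
Proof.
move=> /(fin_num_edom (g_gtNy u)) ud /(fin_num_edom (fc_gtNy v)) vd.
by rewrite /Lagr -(fineK ud) -(fineK vd) -!EFinD -addrA.
Qed.

(** Real-valued form of [gap], meaningful for points of the two domains, where [fine] is applied to
    finite values. *)
Definition pdgap u v := (G u + Phi D u ys - F ys) - (G xs + Phi D xs v - F v).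

Lemma pdgap_ge0 u v : edom (pg D) u -> edom fc v -> 0 <= pdgap u v.
Proof.
move=> ud vd; have [_ _ /(_ u v ud vd)] := hs.
rewrite !Lagr_fine// !lee_fin => -[h1 h2].
by rewrite subr_ge0 (le_trans h1).
Qed.

Lemma Phi_differentiable u v : edom (pg D) u ->
  differentiable (fun u => Phi D u v) u.
Proof.
move=> ud; apply: (@differentiableD _ _ _ (ph D) (fun u => dotv (pH D u) v)).
  exact: (sa_h_diff (asc_standing hD)).
by apply: differentiable_dotl; exact: (sa_H_diff (asc_standing hD)).
Qed.

Lemma Phi_convex v : edom fc v -> convex_on (edom (pg D)) (fun u => Phi D u v).
Proof.
move=> vd u u' t ud ud' t0 t1; split.
  by have [] := econvex_fine g_gtNy g_convex ud ud' t0 t1.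
rewrite /Phi !mulrDr addrACA lerD//.
  by apply: (convex_function_ineq (sa_h_convex (asc_standing hD))).
exact: (convex_function_ineq (asc_H_convex hD vd)).
Qed.

Lemma Phi_grad_le u u' v : edom (pg D) u -> edom (pg D) u' -> edom fc v ->
  dotv (gradx_Phi D u v) (u' - u) <= Phi D u' v - Phi D u v.
Proof.
move=> ud ud' vd.
apply: (@convex_grad_le _ _ (fun w => Phi D w v)); first exact: Phi_differentiable.
by move=> t t0 t1; have [] := Phi_convex vd ud' ud t0 t1.
Qed.

(** * Step sizes, feasibility of the iterates and proximal inequalities *)

Lemma tau_gt0 n : 0 < tau n.
Proof.
elim: n => [|n IH]; first by rewrite (alg_tau0 hS); case/andP: (vp_tau0 hP).
have [i [-> _ _ _]] := alg_tau hS n.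
by rewrite mulr_gt0 ?exprn_gt0// lt_min mulr_gt0.
Qed.

Lemma tau_le_max n : tau n <= taumax.
Proof.
case: n => [|n]; first by rewrite (alg_tau0 hS); case/andP: (vp_tau0 hP).
have [i [-> _ _ _]] := alg_tau hS n.
rewrite -[leRHS]mulr1 ler_pM ?exprn_ge0 ?exprn_ile1 ?(ltW mu0)//.
  by rewrite le_min !ltW// mulr_gt0// tau_gt0.
by rewrite ge_min lexx orbT.
Qed.

Lemma tau_le_vphi n : tau n.+1 <= vphi * tau n.
Proof.
have [i [-> _ _ _]] := alg_tau hS n.
rewrite -[leRHS]mulr1 ler_pM ?exprn_ge0 ?exprn_ile1 ?(ltW mu0)//.
  by rewrite le_min !ltW// mulr_gt0// tau_gt0.
by rewrite ge_min lexx.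
Qed.

Let rho_den n : 0 < psi + gamma * vphi * tau n.
Proof. by rewrite addr_gt0// !mulr_gt0// tau_gt0. Qed.

Lemma rho_gt0 n : 0 < rho gamma P it n.
Proof. by rewrite divr_gt0. Qed.

Lemma rho_lt1 n : rho gamma P it n < 1.
Proof.
rewrite ltr_pdivrMr// mul1r; have := mulr_gt0 (mulr_gt0 gamma0 vphi0) (tau_gt0 n).
by move: vphi0; lra.
Qed.

Lemma beta_gt0 n : 0 < beta n.
Proof.
elim: n => [|n IH]; first by rewrite (alg_beta0 hS) (vp_beta0 hP).
by rewrite (alg_beta hS) mulr_gt0// addr_gt0// mulr_gt0 ?tau_gt0// mulr_gt0// rho_gt0.
Qed.

Lemma x_dom n : edom (pg D) (X n).
Proof.
case: n => [|n]; first exact: alg_x0 hS.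
by have [] := prox_subdifferential g_proper g_convex (tau_gt0 n) (alg_x hS n).
Qed.

(** The proximal step supplies the subgradient at which strong convexity of [g] is applied; the last
    term, the gain from [gamma], later pays for the growth of [beta]. *)
Lemma x_ineq n u : edom (pg D) u ->
  tau n * (G (X n.+1) - G u) <= dotv (X n.+1 - xmd P it n) (u - X n.+1)
    + tau n * dotv (gradx_Phi D (X n) (Y n)) (u - X n.+1)
    - gamma * tau n / 2 * enorm (u - X n.+1) ^+ 2.
Proof.
move=> ud; have t0 := tau_gt0 n.
have [xd sub] := prox_subdifferential g_proper g_convex t0 (alg_x hS n).
have := asc_g hD ud xd sub.
rewrite -(fineK (fin_num_edom (g_gtNy _) xd)).
rewrite -(fineK (fin_num_edom (g_gtNy _) ud)) -EFinD lee_fin /= dotvZl.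
move: (X n.+1) (gradx_Phi _ _ _) => x' gr h.
have -> : dotv (x' - xmd P it n) (u - x') + tau n * dotv gr (u - x')
   = - dotv (xmd P it n - tau n *: gr - x') (u - x') by rewrite !dotvE; ring.
move: (dotv _ _) h => d; rewrite -(ler_pM2l t0) !mulrDr (mulrA _ _^-1).
by rewrite divff ?gt_eqF// mul1r; lra.
Qed.

(** Stated for an arbitrary trial point, because the dual points of rejected steps have to be
    bounded as well. *)
Lemma trial_ineq n t y v : 0 < t -> trial D P it n t y -> edom fc v ->
  edom fc y /\
  beta n.+1 * t * (F y - F v) <= dotv (y - ymd P it n) (v - y)
    - beta n.+1 * t * dotv (pH D (X n.+1)) (v - y).
Proof.
move=> t0 tr vd; have l0 : 0 < beta n.+1 * t by rewrite mulr_gt0// beta_gt0.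
have [yd sub] := prox_subdifferential fc_proper fc_convex l0 tr.
split=> //; have := sub v.
rewrite -(fineK (fin_num_edom (fc_gtNy _) yd)).
rewrite -(fineK (fin_num_edom (fc_gtNy _) vd)) -EFinD lee_fin /= dotvZl.
rewrite grady_PhiE; move: (beta _ * t) l0 => l l0 h.
have -> : dotv (y - ymd P it n) (v - y) - l * dotv (pH D (X n.+1)) (v - y)
   = - dotv (ymd P it n + l *: pH D (X n.+1) - y) (v - y).
  by rewrite !dotvE; ring.
move: (dotv _ _) h => d; rewrite -(ler_pM2l l0) !mulrDr (mulrA _ _^-1).
by rewrite divff ?gt_eqF// mul1r; lra.
Qed.

Lemma y_trial n : trial D P it n (tau n.+1) (Y n.+1).
Proof. by have [i [-> tr _ _]] := alg_tau hS n. Qed.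

Lemma y_dom n : edom fc (Y n).
Proof.
case: n => [|n]; first exact: alg_y0 hS.
by have [] := trial_ineq (tau_gt0 _) (y_trial n) ys_dom.
Qed.

(** * Lyapunov energy, its decrease, and the gap at the ergodic means *)

(* Indexed so that [energy 0] is [A1]. *)
Definition energy n :=
  a * enorm (X n.+1 - xs) ^+ 2
  + ((1 - a) * psi + (1 - a) * gamma * tau n.+1) / (psi - 1)
    * enorm (Z n.+2 - xs) ^+ 2
  + (a + kappa gamma P it n * beta n / beta n.+1) * enorm (X n.+1 - X n) ^+ 2
  + b / beta n.+1 * enorm (Y n - ys) ^+ 2
  + 1 / beta n.+1 * enorm (Zb n.+1 - ys) ^+ 2.

(* The proximal inequality of [X n.+2] tested at [xs] is added to the one of
   [X n.+1] tested at [X n.+2]; the negative dual terms left by [dual_one_step]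
   are exactly those that the linesearch spends on the gradient difference. *)
Lemma energy_step n :
  2 * tau n.+1 * pdgap (X n.+1) (Y n.+1)
  + a * (1 + gamma * tau n.+1) * enorm (X n.+2 - xs) ^+ 2
  + (1 - a) * (1 + gamma * tau n.+1) * psi / (psi - 1) * enorm (Z n.+3 - xs) ^+ 2
  + (a + omega1 P * delta n.+1 + gamma * tau n.+1) * enorm (X n.+2 - X n.+1) ^+ 2
  + b / beta n.+1 * enorm (Y n.+1 - ys) ^+ 2
  + 1 / beta n.+1 * enorm (Zb n.+2 - ys) ^+ 2
  <= energy n.
Proof.
have t0 := tau_gt0 n; have t1 := tau_gt0 n.+1; have be0 := beta_gt0 n.+1.
have d0 : 0 < delta n.+1 by rewrite (alg_delta hS) divr_gt0.
have dv : delta n.+1 <= vphi.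
  by rewrite (alg_delta hS) ler_pdivrMr// tau_le_vphi.
have dt : delta n.+1 * tau n = tau n.+1.
  by rewrite (alg_delta hS) divfK// gt_eqF.
have h1 := x_ineq n.+1 xs_dom.
have := x_ineq n (x_dom n.+2).
(* Multiplication by [delta n.+1] turns the weight [tau n] into [tau n.+1], so that the values of
   [g] at [X n.+2] cancel against those in [h1]. *)
rewrite -(ler_pM2l d0) => h2.
have [_ h3] := trial_ineq t1 (y_trial n) ys_dom.
have h4 := Phi_grad_le (x_dom n.+1) xs_dom (y_dom n.+1).
rewrite -(ler_pM2l t1) in h4.
(* With this Young constant the gradient term becomes the left side of the linesearch test, and the
   other term is the [(1 - a) * xi * delta] term provided for in [primal_one_step]. *)
have c0 : 0 < tau n / ((1 - a) * xi) by rewrite divr_gt0// mulr_gt0.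
have h5 := dotv_young (gradx_Phi D (X n.+1) (Y n.+1) - gradx_Phi D (X n) (Y n))
  (X n.+1 - X n.+2) c0.
rewrite -(ler_pM2l t1) (enormB (X n.+1)) in h5.
have [i [tE _ h6 _]] := alg_tau hS n; rewrite -tE /accept in h6.
have xi1 : 0 < xi1_ P < 1 / vphi := vp_xi1 hP.
have d01 : 0 < delta n.+1 <= vphi by rewrite d0.
have g0 : 0 <= gamma * tau n.+1 by rewrite mulr_ge0// ltW.
have h7 := @primal_one_step _ _ _ _ xi _ _ _ _ _ (X n) (X n.+1) (X n.+2) _ _ _ xs
  psi1 (vp_a hP) vphi0 xi1 g0 d01 (alg_z hS n.+1) (alg_z hS n.+2) (erefl (omega1 P)).
rewrite -/(xmd P it n) -/(xmd P it n.+1) in h7.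
have h8 := @dual_one_step _ _ _ (Y n) _ _ _ ys (alg_zb hS n.+1).
rewrite -/(ymd P it n) in h8.
have grE : dotv (gradx_Phi D (X n.+1) (Y n.+1)) (xs - X n.+2)
    + dotv (gradx_Phi D (X n) (Y n)) (X n.+2 - X n.+1)
  = dotv (gradx_Phi D (X n.+1) (Y n.+1)) (xs - X n.+1)
    + dotv (gradx_Phi D (X n.+1) (Y n.+1) - gradx_Phi D (X n) (Y n))
        (X n.+1 - X n.+2).
  by rewrite !dotvE; ring.
have PhiE : Phi D (X n.+1) ys
    = Phi D (X n.+1) (Y n.+1) + dotv (pH D (X n.+1)) (ys - Y n.+1).
  by rewrite /Phi !dotvE; ring.
rewrite /pdgap PhiE /energy.
have k5 : tau n.+1 * (2 * dotv (gradx_Phi D (X n.+1) (Y n.+1)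
      - gradx_Phi D (X n) (Y n)) (X n.+1 - X n.+2)) <=
    kappa gamma P it n * beta n / beta n.+1 * enorm (X n.+1 - X n) ^+ 2
    + b / beta n.+1 * enorm (Y n.+1 - Y n) ^+ 2
    + 1 / beta n.+1 * (1 - b) * (1 + b) * enorm (Y n.+1 - Zb n.+1) ^+ 2
    + (1 - a) * xi * delta n.+1 * enorm (X n.+2 - X n.+1) ^+ 2.
  apply: (le_trans h5); rewrite mulrDr lerD//.
    by rewrite (mulrA (tau n.+1) (_ / _)) (mulrA (tau n.+1) (tau n)).
  rewrite (mulrA (tau n.+1)) (alg_delta hS) le_eqVlt; apply/orP; left; apply/eqP.
  by field; rewrite !gt_eqF.
rewrite -(ler_pM2l (_ : 0 < (beta n.+1)^-1)) ?invr_gt0// in h3.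
have k3 : tau n.+1 * (F (Y n.+1) - F ys) <=
    (beta n.+1)^-1 * dotv (Y n.+1 - ymd P it n) (ys - Y n.+1)
    - tau n.+1 * dotv (pH D (X n.+1)) (ys - Y n.+1).
  apply: le_trans (le_trans h3 _); rewrite le_eqVlt; apply/orP; left; apply/eqP;
    by field; rewrite gt_eqF.
have k8 := congr1 (fun e => (beta n.+1)^-1 * e) h8.
have k2 : tau n.+1 * (G (X n.+1) - G (X n.+2)) <=
    delta n.+1 * dotv (X n.+1 - xmd P it n) (X n.+2 - X n.+1)
    + tau n.+1 * dotv (gradx_Phi D (X n) (Y n)) (X n.+2 - X n.+1)
    - gamma * tau n.+1 / 2 * enorm (X n.+2 - X n.+1) ^+ 2.
  by move: h2; rewrite -dt; lra.
have kE := congr1 (fun e => tau n.+1 * e) grE.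
move: h1 k2 k3 h4 k5 h7 k8 kE; rewrite /= !div1r.
clear h2 h3 h5 h6 h8 grE PhiE dt c0 tE xi1 d01 dv d0 be0 t0 t1 g0 i.
move: (fine _) (fine _) (fine _) (fine _) (fine _) => G1 G2 G3 F1 F2.
lra.
Qed.

(* [rho] is chosen so that the coefficients of [Z n.+3] match with equality when
   [tau n.+2 = vphi * tau n.+1]. *)
Lemma energy_weight n : beta n.+2 * energy n.+1 <= beta n.+1 *
  (a * (1 + gamma * tau n.+1) * enorm (X n.+2 - xs) ^+ 2
  + (1 - a) * (1 + gamma * tau n.+1) * psi / (psi - 1) * enorm (Z n.+3 - xs) ^+ 2
  + (a + omega1 P * delta n.+1 + gamma * tau n.+1) * enorm (X n.+2 - X n.+1) ^+ 2
  + b / beta n.+1 * enorm (Y n.+1 - ys) ^+ 2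
  + 1 / beta n.+1 * enorm (Zb n.+2 - ys) ^+ 2).
Proof.
have b10 := beta_gt0 n.+1; have b20 := beta_gt0 n.+2.
have t0 := tau_gt0 n.+1; have r0 := rho_gt0 n.+1; have r1 := rho_lt1 n.+1.
have gt0 : 0 < gamma * tau n.+1 by rewrite mulr_gt0.
have rt : gamma * rho gamma P it n.+1 * tau n.+1 <= gamma * tau n.+1.
  by rewrite mulrAC ler_piMr// ltW.
have bE := alg_beta hS n.+1.
have c1 : beta n.+2 * a <= beta n.+1 * (a * (1 + gamma * tau n.+1)).
  by rewrite bE mulrAC mulrC (mulrC _ a) !ler_pM2l// lerD2l.
have c2 : beta n.+2 * (((1 - a) * psi + (1 - a) * gamma * tau n.+2) / (psi - 1))
    <= beta n.+1 * ((1 - a) * (1 + gamma * tau n.+1) * psi / (psi - 1)).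
  have tv : psi + gamma * tau n.+2 <= psi + gamma * (vphi * tau n.+1).
    by rewrite lerD2l ler_pM2l// tau_le_vphi.
  have u0 : 0 < 1 + gamma * rho gamma P it n.+1 * tau n.+1.
    by rewrite addr_gt0// mulr_gt0// mulr_gt0.
  have c0 : 0 < beta n.+1 * (1 - a) / (psi - 1).
    by rewrite divr_gt0 ?subr_gt0// mulr_gt0// -subr_gt0.
  have := tv; rewrite -(ler_pM2l u0) -(ler_pM2l c0) => h.
  apply: le_trans (le_trans h _); rewrite le_eqVlt; apply/orP; left; apply/eqP.
    by rewrite bE; field; rewrite gt_eqF// subr_gt0.
  by rewrite /rho; field; rewrite !gt_eqF ?subr_gt0.
(* The [a] share of [gamma * tau n.+1] pays for the growth of [beta]; the [1 - a] share is the
   second summand of [kappa]. *)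
have c3 : beta n.+2 * (a + kappa gamma P it n.+1 * beta n.+1 / beta n.+2)
    <= beta n.+1 * (a + omega1 P * delta n.+1 + gamma * tau n.+1).
  rewrite mulrDr mulrCA divff ?gt_eqF// mulr1 /kappa.
  have := c1; lra.
have c4 : beta n.+2 * (b / beta n.+2) <= beta n.+1 * (b / beta n.+1).
  by rewrite !(mulrCA _ b) !divff ?gt_eqF.
have c5 : beta n.+2 * (1 / beta n.+2) <= beta n.+1 * (1 / beta n.+1).
  by rewrite !(mulrCA _ 1) !divff ?gt_eqF.
have k1 := ler_wpM2r (sqr_ge0 (enorm (X n.+2 - xs))) c1.
have k2 := ler_wpM2r (sqr_ge0 (enorm (Z n.+3 - xs))) c2.
have k3 := ler_wpM2r (sqr_ge0 (enorm (X n.+2 - X n.+1))) c3.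
have k4 := ler_wpM2r (sqr_ge0 (enorm (Y n.+1 - ys))) c4.
have k5 := ler_wpM2r (sqr_ge0 (enorm (Zb n.+2 - ys))) c5.
have := lerD (lerD (lerD (lerD k1 k2) k3) k4) k5.
by rewrite -!(mulrA (beta _)) -!mulrDr.
Qed.

Lemma energy_decrease n :
  beta n.+2 * energy n.+1
    + 2 * (beta n.+1 * tau n.+1 * pdgap (X n.+1) (Y n.+1))
  <= beta n.+1 * energy n.
Proof.
have := energy_weight n; have := energy_step n.
rewrite -(ler_pM2l (beta_gt0 n.+1)) -!addrA [in leLHS]mulrDr !addrA => h1 h2.
have := lerD h2 h1; rewrite /GRing.natmul /=.
lra.
Qed.

Lemma energy_sum N :
  beta N.+1 * energy N
    + 2 * \sum_(1 <= n < N.+1) beta n * tau n * pdgap (X n) (Y n)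
  <= beta 1%N * energy 0.
Proof.
elim: N => [|N IH]; first by rewrite big_geq// mulr0 addr0.
rewrite big_nat_recr//=; have := energy_decrease N; lra.
Qed.

Lemma energyE0 : energy 0 = A1 gamma P it xs ys.
Proof. by []. Qed.

(** [pdgap] is a convex function of [u] plus a convex function of [v] plus a constant, so Jensen's
    inequality applies to the primal and the dual mean separately. *)
Lemma gap_mean_le N : (1 <= N)%N ->
  (gap D xs ys (xhat it N) (yhat it N) <=
    ((\sum_(1 <= n < N.+1) beta n * tau n * pdgap (X n) (Y n)) / sN it N)%:E)%E.
Proof.
move=> N1; have w0 k : 0 < beta k.+1 * tau k.+1 by rewrite mulr_gt0 ?beta_gt0 ?tau_gt0.
have s0 : 0 < sN it N.
  rewrite /sN; case: N N1 => // N _; rewrite big_nat_recr//= ltr_wpDl//.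
  by rewrite big_add1 sumr_ge0// => i _; exact: ltW.
have c1 : convex_on (edom (pg D)) (fun u => G u + Phi D u ys).
  by apply: convex_onD; [exact: econvex_fine|exact: Phi_convex].
have c2 : convex_on (edom fc) (fun v => F v + - dotv (pH D xs) v).
  move=> v v' t vd vd' t0 t1; have [h1 h2] := econvex_fine fc_gtNy fc_convex vd vd' t0 t1.
  by split=> //; move: h2; rewrite !dotvE; lra.
have [xd hx] := convex_on_mean (w := fun k => beta k * tau k) c1 w0 (fun k => x_dom k.+1) N1.
have [yd hy] := convex_on_mean (w := fun k => beta k * tau k) c2 w0 (fun k => y_dom k.+1) N1.
rewrite -/(sN it N) -/(xhat it N) in xd hx; rewrite -/(sN it N) -/(yhat it N) in yd hy.
rewrite /gap !Lagr_fine// -EFinB lee_fin ler_pdivlMr// mulrC.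
have -> : \sum_(1 <= n < N.+1) beta n * tau n * pdgap (X n) (Y n) =
    \sum_(1 <= n < N.+1) beta n * tau n * (G (X n) + Phi D (X n) ys)
    + \sum_(1 <= n < N.+1) beta n * tau n * (F (Y n) + - dotv (pH D xs) (Y n))
    - sN it N * (G xs + ph D xs + F ys).
  rewrite mulr_suml -sumrN -!big_split/=; apply: eq_bigr => n _.
  by rewrite /pdgap /(Phi D xs); ring.
by rewrite /(Phi D xs); move: hx hy; lra.
Qed.

(** * Monotonicity of [beta] and bounds on the iterates *)

Lemma beta_ratio n : beta n <= beta n.+1 <= (1 + gamma * taumax) * beta n.
Proof.
have r0 := rho_gt0 n; have r1 := rho_lt1 n; have t0 := tau_gt0 n.
have h : 0 <= gamma * rho gamma P it n * tau n <= gamma * taumax.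
  apply/andP; split; first by rewrite ltW// mulr_gt0// mulr_gt0.
  by rewrite -mulrA ler_pM2l// -[leRHS]mul1r ler_pM ?tau_le_max// ltW.
case/andP: h => h1 h2; rewrite (alg_beta hS) ler_pM2r ?beta_gt0// lerD2l h2 andbT.
by rewrite ler_peMl ?(ltW (beta_gt0 _))// lerDl.
Qed.

Lemma beta_mono m n : (m <= n)%N -> beta m <= beta n.
Proof.
elim: n => [|n IH]; first by rewrite leqn0 => /eqP ->.
rewrite leq_eqVlt => /orP[/eqP -> //|/IH h].
by apply: le_trans h _; have /andP[] := beta_ratio n.
Qed.

Lemma kappa_ge n : (1 - a) * gamma * tau n <= kappa gamma P it n.
Proof.
rewrite lerDr mulr_ge0 ?(ltW (vp_omega1 hP))//.
case: n => [|n]; first by rewrite (alg_delta0 hS) ltW// (vp_delta0 hP).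
by rewrite (alg_delta hS) divr_ge0 ?ltW ?tau_gt0.
Qed.

Lemma weighted_gap_ge0 N :
  0 <= \sum_(1 <= n < N.+1) beta n * tau n * pdgap (X n) (Y n).
Proof.
apply: sumr_ge0 => n _; apply: mulr_ge0; last exact: pdgap_ge0 (x_dom n) (y_dom n).
by rewrite ltW// mulr_gt0 ?beta_gt0 ?tau_gt0.
Qed.

Lemma energy_ge n : [/\ a * enorm (X n.+1 - xs) ^+ 2 <= energy n &
  1 / beta n.+1 * enorm (Zb n.+1 - ys) ^+ 2 <= energy n].
Proof.
have k0 : 0 <= kappa gamma P it n.
  by apply: le_trans (kappa_ge n); rewrite !mulr_ge0 ?ltW ?tau_gt0.
have e1 : 0 <= a * enorm (X n.+1 - xs) ^+ 2 by rewrite mulr_ge0 ?sqr_ge0 ?ltW.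
have e2 : 0 <= ((1 - a) * psi + (1 - a) * gamma * tau n.+1) / (psi - 1)
    * enorm (Z n.+2 - xs) ^+ 2.
  rewrite mulr_ge0 ?sqr_ge0// divr_ge0 ?subr_ge0 ?(ltW psi1)//.
  by rewrite ltW// addr_gt0 ?mulr_gt0// ?tau_gt0.
have e3 : 0 <= (a + kappa gamma P it n * beta n / beta n.+1)
    * enorm (X n.+1 - X n) ^+ 2.
  rewrite mulr_ge0 ?sqr_ge0// addr_ge0 ?(ltW a0)// divr_ge0 ?(ltW (beta_gt0 _))//.
  by rewrite mulr_ge0 ?(ltW (beta_gt0 _)).
have e4 : 0 <= b / beta n.+1 * enorm (Y n - ys) ^+ 2.
  by rewrite mulr_ge0 ?sqr_ge0// divr_ge0 ?(ltW (beta_gt0 _)).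
have e5 : 0 <= 1 / beta n.+1 * enorm (Zb n.+1 - ys) ^+ 2.
  by rewrite mulr_ge0 ?sqr_ge0// divr_ge0 ?(ltW (beta_gt0 _)).
rewrite /energy; split; lra.
Qed.

Lemma weighted_energy_le n : beta n.+1 * energy n <= beta 1%N * energy 0.
Proof.
apply: le_trans (energy_sum n); rewrite lerDl mulr_ge0//.
exact: weighted_gap_ge0.
Qed.

Lemma x_bound : exists2 M : R, 0 <= M &
  forall n, Num.sqrt (beta n.+1) * enorm (X n.+1 - xs) <= M.
Proof.
exists (Num.sqrt (beta 1%N * energy 0 / a)); first exact: sqrtr_ge0.
move=> n; rewrite -(@ger0_norm _ (enorm _)) ?enorm_ge0// -sqrtr_sqr.
rewrite -sqrtrM ?(ltW (beta_gt0 _))// ler_wsqrtr// ler_pdivlMr//.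
apply: le_trans (weighted_energy_le n).
have [h _] := energy_ge n.
by rewrite -mulrA ler_pM2l ?beta_gt0// mulrC.
Qed.

(** In [energy] the dual distance carries the factor [1 / beta], so the weighted bound gives
    boundedness here and not decay as in [x_bound]. *)
Lemma zb_bound : exists2 M : R, 0 <= M &
  forall n, enorm (Zb n.+1 - ys) <= M.
Proof.
exists (Num.sqrt (beta 1%N * energy 0)); first exact: sqrtr_ge0.
move=> n; rewrite -(@ger0_norm _ (enorm _)) ?enorm_ge0// -sqrtr_sqr.
rewrite ler_wsqrtr//; apply: le_trans (weighted_energy_le n).
have [_ h] := energy_ge n.
by rewrite -ler_pdivrMl ?beta_gt0// -div1r.
Qed.

(** Since [b] may be 0, the term with [b] in [energy] does not control [Y]. Instead [Y n.+1] is
    recovered from two consecutive [Zb] by solving the averaging recursion, at the price of the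
    factor [(1 - b)^-1]. *)
Lemma y_bound : exists2 M : R, 0 <= M &
  forall n, enorm (Y n.+1 - ys) <= M /\ enorm (ymd P it n.+1 - ys) <= M.
Proof.
have [M M0 hM] := zb_bound.
have b1V : 1 <= (1 - b)^-1 by rewrite invf_ge1// gerBl.
have yM n : enorm (Y n.+1 - ys) <= 2 * M / (1 - b).
  have -> : Y n.+1 - ys
      = (1 - b)^-1 *: ((Zb n.+2 - ys) + (- b) *: (Zb n.+1 - ys)).
    rewrite (alg_zb hS n.+1); apply/rowP => j; rewrite !mxE; field.
    by rewrite gt_eqF.
  rewrite enormZ gtr0_norm ?invr_gt0// mulrC ler_pM2r ?invr_gt0//.
  rewrite (le_trans (enormD _ _))// enormZ normrN ger0_norm//.
  have := hM n; have := hM n.+1; have := enorm_ge0 (Zb n.+1 - ys).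
  by move: b0 b1 M0; nra.
exists (2 * M / (1 - b)); first by rewrite divr_ge0 ?mulr_ge0// ltW.
move=> n; split=> //.
have -> : ymd P it n.+1 - ys = b *: (Y n.+1 - ys) + (1 - b) *: (Zb n.+2 - ys).
  by apply/rowP => j; rewrite !mxE; ring.
rewrite (le_trans (enormD _ _))// !enormZ (ger0_norm b0) (gtr0_norm b1).
have h1 := yM n; have h2 := hM n.+1.
have h3 : M <= 2 * M / (1 - b) by move: M0; nra.
by move: b0 b1; nra.
Qed.

(** * Dual points of trial steps and lower bounds for the step size *)

Lemma saddle_dual_ineq v : edom fc v ->
  dotv (pH D xs) (v - ys) <= F v - F ys.
Proof.
move=> vd; have := pdgap_ge0 xs_dom vd.
by rewrite /pdgap /Phi !dotvE; lra.
Qed.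

(* Only the part of [pH D u - pH D xs] seen by [dom fc - dom fc] is controlled
   by the Lipschitz assumption; a long segment is first cut at unit length so
   that the Lipschitz constants do not depend on [v]. *)
Lemma coupling_bound (r : R) : exists Lxx Lxy : R, [/\ 0 <= Lxx, 0 <= Lxy &
  forall u v, edom (pg D) u -> edom fc v -> enorm (u - xs) <= r ->
    1 <= enorm (v - ys) ->
    dotv (pH D u - pH D xs) (v - ys)
      <= enorm (v - ys) * ((Lxx * enorm (u - xs) + Lxy) * enorm (u - xs))].
Proof.
(* [Num.max r 0] places [xs] in [A] also for negative [r]. *)
pose A : set 'rV[R]_q := [set u | enorm (u - xs) <= Num.max r 0].
pose B : set 'rV[R]_p := [set v | enorm (v - ys) <= 1].
have bA : bounded_set A by apply: (@bounded_set_enorm _ _ _ xs (Num.max r 0)).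
have bB : bounded_set B by apply: (@bounded_set_enorm _ _ _ ys 1).
have [Lxx [Lxy [Lxx0 Lxy0 hL]]] := asc_lip hD bA bB.
exists Lxx, Lxy; split=> //; first exact: ltW.
move=> u v ud vd ur; set N := enorm (v - ys) => N1.
have N0 : 0 < N by apply: lt_le_trans N1.
pose v' := ys + N^-1 *: (v - ys).
have v'E : v' - ys = N^-1 *: (v - ys) by rewrite /v' addrAC subrr add0r.
have v'd : edom fc v'.
  have [N1'|N1'] := eqVneq N 1.
    by rewrite /v' N1' invr1 scale1r addrC subrK.
  have NV1 : N^-1 < 1 by rewrite invf_lt1// lt_neqAle eq_sym N1'.
  have NV0 : 0 < N^-1 by rewrite invr_gt0.
  have [] := econvex_fine fc_gtNy fc_convex vd ys_dom NV0 NV1.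
  suff -> : N^-1 *: v + (1 - N^-1) *: ys = v' by [].
  by apply/rowP => j; rewrite !mxE; ring.
have v'1 : enorm (v' - ys) = 1.
  by rewrite v'E enormZ gtr0_norm ?invr_gt0// mulVf// gt_eqF.
(* Adding the gradient inequality at [u] with multiplier [v'] to the one at [xs] with multiplier
   [ys] bounds [<pH D u - pH D xs, v' - ys>] by a gradient difference, to which the Lipschitz bound
   applies. *)
have h1 := Phi_grad_le ud xs_dom v'd.
have h2 := Phi_grad_le xs_dom ud ys_dom.
have h3 : enorm (gradx_Phi D u v' - gradx_Phi D xs ys)
    <= Lxx * enorm (u - xs) + Lxy * enorm (v' - ys).
  apply: hL; split=> //.
  - by rewrite /A/= le_max ur.
  - by rewrite /A/= subrr enorm0 le_max lexx orbT.
  - by rewrite /B/= v'1.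
  - by rewrite /B/= subrr enorm0.
have h4 := dotv_le_enorm (gradx_Phi D u v' - gradx_Phi D xs ys) (u - xs).
have h5 : dotv (pH D u - pH D xs) (v' - ys)
    <= dotv (gradx_Phi D u v' - gradx_Phi D xs ys) (u - xs).
  move: h1 h2; rewrite -(opprB u xs) dotvNr [in X in _ -> _ -> X]dotvDl dotvNl.
  by rewrite /Phi !dotvE; lra.
have -> : dotv (pH D u - pH D xs) (v - ys)
    = N * dotv (pH D u - pH D xs) (v' - ys).
  by rewrite v'E dotvZr mulVKf// gt_eqF.
rewrite ler_pM2l// (le_trans h5)// (le_trans h4)// ler_wpM2r ?enorm_ge0//.
by rewrite (le_trans h3)// v'1 mulr1.
Qed.

(** Testing the dual proximal inequality with [ys] and adding the saddle inequality bounds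
    [|y - ys|^2] by a multiple of [|y - ys|], through [coupling_bound]. With [l = beta n.+2 * t] and
    [d = |X n.+2 - xs|], the multiple involves [l * d] and [l * d ^+ 2]; these stay bounded because
    [sqrt beta * d] does, by [t * sqrt beta <= 1] and [t <= taumax] respectively. *)
Lemma trial_bound : exists M : R, forall n t y,
  0 < t -> t <= taumax -> t * Num.sqrt (beta n.+2) <= 1 ->
  trial D P it n.+1 t y -> enorm (y - ys) <= M.
Proof.
have [Mx Mx0 hMx] := x_bound; have [My My0 hMy] := y_bound.
have sb n : 0 < Num.sqrt (beta n) by rewrite sqrtr_gt0 beta_gt0.
have [Lxx [Lxy [Lxx0 Lxy0 hL]]] := coupling_bound (Mx / Num.sqrt (beta 0%N)).
exists (1 + (My + (Lxx * (taumax * Mx ^+ 2) + Lxy * Mx))) => n t y t0 tm tb tr.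
have [yd h1] := trial_ineq t0 tr ys_dom.
have h2 := saddle_dual_ineq yd.
set w := enorm (y - ys); have [w1|/ltW w1] := leP w 1.
  rewrite (le_trans w1)// lerDl addr_ge0// addr_ge0 ?mulr_ge0 ?exprn_ge0//.
  exact: ltW.
have w0 : 0 < w by apply: lt_le_trans w1.
have dx : enorm (X n.+2 - xs) <= Mx / Num.sqrt (beta 0%N).
  rewrite ler_pdivlMr// mulrC (le_trans _ (hMx n.+1))//.
  by rewrite ler_wpM2r ?enorm_ge0// ler_wsqrtr// beta_mono.
have h3 := hL _ _ (x_dom n.+2) yd dx w1.
set l := beta n.+2 * t in h1; have l0 : 0 < l by rewrite mulr_gt0 ?beta_gt0.
rewrite -(ler_pM2l l0) in h2; rewrite -(ler_pM2l l0) in h3.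
have h4 : w ^+ 2 <= dotv (ymd P it n.+1 - ys) (y - ys)
    + l * dotv (pH D (X n.+2) - pH D xs) (y - ys).
  have e1 : dotv (y - ys) (y - ys)
    = dotv (y - ymd P it n.+1) (y - ys) + dotv (ymd P it n.+1 - ys) (y - ys).
    by rewrite !dotvE; ring.
  have e2 : dotv (pH D (X n.+2) - pH D xs) (y - ys)
    = dotv (pH D (X n.+2)) (y - ys) - dotv (pH D xs) (y - ys).
    by rewrite dotvDl dotvNl.
  by move: h1 h2; rewrite /w sqr_enorm e1 e2 -(opprB y ys) !dotvNr; lra.
have h5 := dotv_le_enorm (ymd P it n.+1 - ys) (y - ys).
have [_ hmd] := hMy n.
set d := enorm (X n.+2 - xs) in h3; have d0 : 0 <= d by exact: enorm_ge0.
have sd : Num.sqrt (beta n.+2) * d <= Mx := hMx n.+1.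
have ld : l * d <= Mx.
  rewrite /l -[beta n.+2]sqr_sqrtr ?(ltW (beta_gt0 _))// expr2.
  have -> : Num.sqrt (beta n.+2) * Num.sqrt (beta n.+2) * t * d
    = (t * Num.sqrt (beta n.+2)) * (Num.sqrt (beta n.+2) * d) by ring.
  rewrite (le_trans _ sd)// ler_piMl// mulr_ge0// ltW//.
have ldd : l * d ^+ 2 <= taumax * Mx ^+ 2.
  rewrite /l -[beta n.+2]sqr_sqrtr ?(ltW (beta_gt0 _))//.
  have -> : Num.sqrt (beta n.+2) ^+ 2 * t * d ^+ 2
    = t * (Num.sqrt (beta n.+2) * d) ^+ 2 by ring.
  rewrite ler_pM ?sqr_ge0 ?(ltW t0)// ler_pXn2r ?nnegrE ?mulr_ge0// ltW//.
have h6 : w ^+ 2 <= w * (My + (Lxx * (taumax * Mx ^+ 2) + Lxy * Mx)).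
  apply: le_trans h4 _; rewrite mulrDr lerD//.
    by rewrite (le_trans h5)// mulrC ler_pM2l.
  apply: le_trans h3 _; rewrite mulrCA ler_pM2l//.
  have := ler_wpM2l Lxx0 ldd; have := ler_wpM2l Lxy0 ld; lra.
move: h6; rewrite expr2 ler_pM2l// => h6; apply: (le_trans h6).
by rewrite lerDr.
Qed.

(* Trial steps with [t * Num.sqrt (beta n.+2) > 1] are excluded because their
   dual points need not be bounded; such steps are long enough anyway. *)
Lemma rejected_step : exists k : R, [/\ 0 < k & forall n t y,
  0 < t -> t <= taumax -> t * Num.sqrt (beta n.+2) <= 1 ->
  trial D P it n.+1 t y -> ~ accept gamma D P it n.+1 t y ->
  k <= t \/ k <= t * tau n.+1 * beta n.+2].
Proof.
have [Mt hMt] := trial_bound.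
have [Mx Mx0 hMx] := x_bound; have [My My0 hMy] := y_bound.
have sb n : 0 < Num.sqrt (beta n) by rewrite sqrtr_gt0 beta_gt0.
pose Rx := Mx / Num.sqrt (beta 0%N); pose Ry := Num.max Mt My.
pose A : set 'rV[R]_q := [set u | enorm (u - xs) <= Rx].
pose B : set 'rV[R]_p := [set v | enorm (v - ys) <= Ry].
have bA : bounded_set A by apply: (@bounded_set_enorm _ _ _ xs Rx).
have bB : bounded_set B by apply: (@bounded_set_enorm _ _ _ ys Ry).
have [Lxx [Lxy [Lxx0 Lxy0 hL]]] := asc_lip hD bA bB.
have AX n : A (X n.+1).
  rewrite /A/= ler_pdivlMr// mulrC (le_trans _ (hMx n))//.
  by rewrite ler_wpM2r ?enorm_ge0// ler_wsqrtr// beta_mono.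
pose C := ((1 - a) * xi)^-1.
have C0 : 0 < C by rewrite invr_gt0 mulr_gt0.
pose L := 1 + gamma * taumax.
have L0 : 0 < L by rewrite addr_gt0// mulr_gt0.
(* For [b = 0] the term with [b] in the linesearch test vanishes, but then [Zb n.+2 = Y n.+1] and
   the last term takes over with coefficient [1 / beta n.+2]. *)
pose cb := if b == 0 then 1 else b.
have cb0 : 0 < cb.
  by rewrite /cb; case: eqVneq => // bn0; rewrite lt_neqAle eq_sym bn0 b0.
pose e1 := (1 - a) * gamma / L.
have e10 : 0 < e1 by rewrite divr_gt0// mulr_gt0.
have e1L : e1 * L = (1 - a) * gamma by rewrite divfK// gt_eqF.
clearbody e1.
(* The summand 1 keeps this local [A1] positive when [Lxx = 0]. *)
pose A1 := 2 * C * Lxx ^+ 2 + 1; pose B1 := 2 * C * Lxy ^+ 2.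
have A10 : 0 < A1 by rewrite ltr_wpDl// mulr_ge0 ?sqr_ge0// mulr_ge0// ltW.
have B10 : 0 < B1 by rewrite mulr_gt0 ?exprn_gt0// mulr_gt0.
exists (Num.min (e1 / A1) (cb / B1)).
split; first by rewrite lt_min; apply/andP; split; exact: divr_gt0.
move=> n t y t0 tm tb tr; rewrite /accept => /negP; rewrite -ltNge => rej.
have [h1|] := leP (Num.min (e1 / A1) (cb / B1)) t; first by left.
have [h2|] := leP (Num.min (e1 / A1) (cb / B1)) (t * tau n.+1 * beta n.+2).
  by right.
rewrite !lt_min !ltr_pdivlMr// => /andP[_ h2] /andP[h1 _]; exfalso.
have t1 := tau_gt0 n.+1; have be := beta_gt0 n.+2; have be1 := beta_gt0 n.+1.
set dx := enorm (X n.+2 - X n.+1) in rej.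
set dy := enorm (y - Y n.+1) in rej.
set th := enorm (gradx_Phi D _ y - _) in rej.
have By : B y by rewrite /B/= le_max (hMt n t).
have BY : B (Y n.+1) by rewrite /B/= le_max; have [-> _] := hMy n; rewrite orbT.
have [yd _] := trial_ineq t0 tr ys_dom.
have hth : th <= Lxx * dx + Lxy * dy.
  apply: hL; split; by [exact: AX|exact: x_dom|exact: y_dom| | ].
have th2 : th ^+ 2 <= 2 * (Lxx ^+ 2 * dx ^+ 2) + 2 * (Lxy ^+ 2 * dy ^+ 2).
  apply: (@le_trans _ _ ((Lxx * dx + Lxy * dy) ^+ 2)).
    rewrite ler_pXn2r ?nnegrE ?enorm_ge0//.
    by rewrite addr_ge0// mulr_ge0 ?enorm_ge0// ltW.
  by have := sqr_ge0 (Lxx * dx - Lxy * dy); lra.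
have lhs : t * tau n.+1 / ((1 - a) * xi) * th ^+ 2 <=
    tau n.+1 * (t * (2 * C * Lxx ^+ 2) * dx ^+ 2) + t * tau n.+1 * B1 * dy ^+ 2.
  have tC : 0 <= t * tau n.+1 * C by rewrite mulr_ge0 ?(ltW C0)// mulr_ge0 ?ltW.
  by apply: le_trans (ler_wpM2l tC th2) _; rewrite /B1; lra.
have kx : tau n.+1 * (t * (2 * C * Lxx ^+ 2) * dx ^+ 2) <=
    kappa gamma P it n.+1 * beta n.+1 / beta n.+2 * dx ^+ 2.
  rewrite mulrA ler_wpM2r ?sqr_ge0// ler_pdivlMr//.
  have q1 : t * (2 * C * Lxx ^+ 2) <= e1.
    by apply/ltW/(le_lt_trans _ h1); rewrite /A1 mulrDr mulr1 lerDl ltW.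
  apply: (@le_trans _ _ (tau n.+1 * e1 * (L * beta n.+1))).
    apply: ler_pM; rewrite ?(ltW be)//; last by have /andP[] := beta_ratio n.+1.
      rewrite mulr_ge0 ?(ltW t1)// mulr_ge0 ?(ltW t0)//.
      by rewrite mulr_ge0 ?sqr_ge0// mulr_ge0// ltW.
    by rewrite ler_pM2l.
  have -> : tau n.+1 * e1 * (L * beta n.+1) = (1 - a) * gamma * tau n.+1 * beta n.+1.
    by rewrite -e1L; ring.
  by rewrite ler_pM2r// kappa_ge.
have ky : t * tau n.+1 * B1 * dy ^+ 2 <= b / beta n.+2 * dy ^+ 2
    + 1 / beta n.+2 * (1 - b) * (1 + b) * enorm (y - Zb n.+2) ^+ 2.
  apply: (@le_trans _ _ (cb / beta n.+2 * dy ^+ 2)).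
    by rewrite ler_wpM2r ?sqr_ge0// ler_pdivlMr// mulrAC ltW.
  rewrite /cb; case: eqVneq => [bb|_].
    by rewrite (alg_zb hS n.+1) bb subr0 scale0r addr0 scale1r mul0r mul0r add0r addr0 !mulr1.
  rewrite lerDl mulr_ge0 ?sqr_ge0// mulr_ge0 ?addr_ge0//.
  by rewrite mulr_ge0 ?(ltW b1)// divr_ge0 ?ltW.
by move: rej lhs kx ky; lra.
Qed.

(** If the first trial is accepted, the step is [vphi * tau n.+1] or [taumax]. Otherwise the last
    rejected trial [t] equals [tau n.+2 / mu], and either [t * sqrt beta > 1] or [rejected_step]
    bounds it from below. *)
Lemma step_lower : exists2 k : R, 0 < k & forall n,
  [\/ vphi * tau n.+1 <= tau n.+2, k <= tau n.+2 * Num.sqrt (beta n.+2)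
    | k <= tau n.+2 * tau n.+1 * beta n.+2].
Proof.
have [k [k0 hk]] := rejected_step.
have sb n : 0 < Num.sqrt (beta n) by rewrite sqrtr_gt0 beta_gt0.
have sb0 n : Num.sqrt (beta 0%N) <= Num.sqrt (beta n).
  by rewrite ler_wsqrtr// beta_mono.
pose k1 := taumax * Num.sqrt (beta 0%N).
pose k2 := mu * (k * Num.sqrt (beta 0%N)).
pose m := Num.min (Num.min k1 mu) (Num.min k2 (mu * k)).
have m1 : m <= k1 by rewrite /m !ge_min lexx.
have m2 : m <= mu by rewrite /m !ge_min lexx orbT.
have m3 : m <= k2 by rewrite /m !ge_min lexx !orbT.
have m4 : m <= mu * k by rewrite /m !ge_min lexx !orbT.
have m0 : 0 < m by rewrite /m !lt_min mu0 !mulr_gt0.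
exists m => // n; have [i [tE _ _ rej]] := alg_tau hS n.+1.
case: i tE rej => [|i] tE rej.
  rewrite expr0 mulr1 in tE.
  have [h|h] := leP (vphi * tau n.+1) taumax.
    by constructor 1; rewrite tE min_l.
  constructor 2; rewrite tE min_r ?(ltW h)//; apply: (le_trans m1).
  by rewrite /k1 ler_pM2l.
have [y tr nacc] := rej i (leqnn _).
set t := Num.min _ _ * _ in tr nacc.
have {}tE : tau n.+2 = mu * t by rewrite tE /t exprS mulrCA.
have t0 : 0 < t by have := tau_gt0 n.+2; rewrite tE pmulr_rgt0.
have tm : t <= taumax.
  rewrite /t -[leRHS]mulr1 ler_pM ?exprn_ge0 ?exprn_ile1 ?(ltW mu0)//.
    by rewrite le_min !ltW// mulr_gt0// tau_gt0.
  by rewrite ge_min lexx orbT.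
clearbody t.
have [tb|tb] := leP (t * Num.sqrt (beta n.+2)) 1; last first.
  constructor 2; rewrite tE; apply: (le_trans m2).
  by rewrite -mulrA ler_peMr ?(ltW mu0) ?(ltW tb).
have [ht|ht] := hk _ _ _ t0 tm tb tr nacc.
  constructor 2; rewrite tE; apply: (le_trans m3).
  by rewrite -mulrA /k2 ler_pM2l// ler_pM ?sqrtr_ge0 ?(ltW k0).
constructor 3; rewrite tE; apply: (le_trans m4).
by rewrite -!mulrA ler_pM2l// mulrA.
Qed.

(** * Linear growth of the square root of [beta] and the convergence rates *)

Lemma sqrt_beta_growth :
  exists2 C : R, 0 < C & forall n, C * n.+1%:R <= Num.sqrt (beta n.+1).
Proof.
have [k k0 hk] := step_lower.
have sb n : 0 < Num.sqrt (beta n) by rewrite sqrtr_gt0 beta_gt0.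
pose L := 1 + gamma * taumax.
have gt0 : 0 < gamma * taumax by rewrite mulr_gt0.
have L0 : 0 < L by rewrite addr_gt0.
have sL n : Num.sqrt (beta n.+1) <= L * Num.sqrt (beta n).
  rewrite -[L]ger0_norm ?(ltW L0)// -sqrtr_sqr -sqrtrM ?sqr_ge0// ler_wsqrtr//.
  have /andP[_ h] := beta_ratio n; apply: (le_trans h).
  by rewrite ler_pM2r ?beta_gt0// expr2 ler_peMr ?(ltW L0)// lerDl ltW.
pose rmin := (psi - vphi) / (psi + gamma * vphi * taumax).
have rden : 0 < psi + gamma * vphi * taumax by rewrite addr_gt0// !mulr_gt0.
have rmin0 : 0 < rmin by rewrite divr_gt0.
have rho_ge n : rmin <= rho gamma P it n.
  rewrite /rmin /rho ler_pM2l// lef_pV2 ?posrE// lerD2l ler_pM2l ?mulr_gt0//.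
  exact: tau_le_max.
clearbody rmin.
(* The increment of [s = sqrt beta] is [(s' ^+ 2 - s ^+ 2) / (s' + s)], and [s' <= L * s] gives the
   divisor [L + 1]. *)
have c0 : 0 < gamma * rmin / (L + 1) by rewrite divr_gt0 ?(addr_gt0 L0)// mulr_gt0.
(* One constant serves two cases of [step_lower]: [1 / r' <= 1 / k] in the second and
   [1 / r' <= L / k * r] in the third. *)
have K0 : 0 <= (1 + L) / k by rewrite ltW// divr_gt0// addr_gt0.
apply: (@linear_growth _ (fun n => Num.sqrt (beta n.+1))
  (fun n => tau n.+1 * Num.sqrt (beta n.+1)) _ _ _ c0 vphi1 K0) => [//|n|n|n].
- by rewrite mulr_gt0 ?tau_gt0.
- have t0 := tau_gt0 n.+1.
  have bE : Num.sqrt (beta n.+2) ^+ 2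
    = (1 + gamma * rho gamma P it n.+1 * tau n.+1) * Num.sqrt (beta n.+1) ^+ 2.
    by rewrite !sqr_sqrtr ?(ltW (beta_gt0 _))// (alg_beta hS).
  move: (sb n.+1) (sL n.+1) (rho_ge n.+1) bE.
  have : Num.sqrt (beta n.+1) <= Num.sqrt (beta n.+2).
    by rewrite ler_wsqrtr// beta_mono.
  move: (Num.sqrt (beta n.+2)) (Num.sqrt (beta n.+1)) (rho _ _ _ _) => s' s rh.
  move=> ss' s0 sL' rge sE.
  rewrite -lerBrDl mulrAC ler_pdivrMr ?addr_gt0// -(ler_pM2r s0).
  have h1 : gamma * rmin * (tau n.+1 * s) * s <= s' ^+ 2 - s ^+ 2.
    have h : gamma * rmin * (tau n.+1 * s ^+ 2) <= gamma * rh * (tau n.+1 * s ^+ 2).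
      by rewrite ler_pM2r ?mulr_gt0 ?exprn_gt0// ler_pM2l.
    by rewrite sE; move: h; lra.
  apply: (le_trans h1).
  have h2 : (s' - s) * (s' + s) <= (s' - s) * ((L + 1) * s).
    by rewrite ler_wpM2l ?subr_ge0// mulrDl mul1r lerD2r.
  by move: h2; lra.
- have r0 : 0 < tau n.+1 * Num.sqrt (beta n.+1) by rewrite mulr_gt0 ?tau_gt0.
  have r'0 : 0 < tau n.+2 * Num.sqrt (beta n.+2) by rewrite mulr_gt0 ?tau_gt0.
  have sm : Num.sqrt (beta n.+1) <= Num.sqrt (beta n.+2).
    by rewrite ler_wsqrtr// beta_mono.
  set r := tau n.+1 * _ in r0 *; set r' := tau n.+2 * _ in r'0 *.
  have rV0 : 0 <= r^-1 / vphi by rewrite divr_ge0 ?invr_ge0 ?ltW.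
  have [h|h|h] := hk n.
  + have h1 : vphi * r <= r'.
      rewrite /r /r' mulrA ler_pM ?sqrtr_ge0// mulr_ge0 ?ltW ?tau_gt0//.
    apply: (@le_trans _ _ (r^-1 / vphi)).
      by rewrite -invfM lef_pV2 ?posrE ?(mulr_gt0 r0)// mulrC.
    by rewrite lerDl mulr_ge0// addr_ge0 ?ltW.
  + have h1 : r'^-1 <= k^-1 by rewrite lef_pV2 ?posrE.
    apply: (le_trans h1); apply: ler_wpDl => //.
    rewrite mulrAC ler_peMl ?invr_ge0 ?(ltW k0)//.
    have := mulr_gt0 L0 r0; move: L0 r0; lra.
  + have h1 : k <= L * (r' * r).
      apply: (le_trans h); rewrite -[beta n.+2]sqr_sqrtr ?(ltW (beta_gt0 _))//.
      have -> : L * (r' * r) = tau n.+2 * tau n.+1 *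
        (Num.sqrt (beta n.+2) * (L * Num.sqrt (beta n.+1))) by rewrite /r /r'; ring.
      by rewrite ler_pM2l ?mulr_gt0 ?tau_gt0// expr2 ler_pM2l.
    have h2 : r'^-1 <= L / k * r.
      rewrite -div1r ler_pdivrMr//.
      have -> : L / k * r * r' = L * (r' * r) / k by ring.
      by rewrite ler_pdivlMr// mul1r.
    apply: (le_trans h2); apply: ler_wpDl => //.
    have kV : 0 < k^-1 by rewrite invr_gt0.
    have := mulr_gt0 kV r0; have := mulr_gt0 L0 kV; lra.
Qed.

Lemma aNPDAL_rates : exists C1 c3 : R, [/\ 0 < C1, 0 < c3 &
  forall N : nat, (1 <= N)%N ->
    enorm (X N.+1 - xs) <= C1 / N.+1%:R /\
    (gap D xs ys (xhat it N) (yhat it N)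
       <= (beta 1%N / c3 * (A1 gamma P it xs ys / N%:R ^+ 2))%:E)%E].
Proof.
have [C C0 hC] := sqrt_beta_growth; have [M M0 hM] := x_bound.
(* As [beta 1 = (1 - e) * beta 2] and [beta 2 <= beta N.+1], the difference [beta N.+1 - beta 1] is
   at least [e * beta N.+1], so the quadratic lower bound for [sN] holds from [N = 1] on. *)
pose e := 1 - beta 1%N / beta 2.
have e0 : 0 < e.
  rewrite subr_gt0 ltr_pdivrMr ?beta_gt0// mul1r (alg_beta hS 1).
  by rewrite ltr_pMl ?beta_gt0// ltrDl mulr_gt0 ?tau_gt0// mulr_gt0 ?rho_gt0.
have s_ge N : beta N.+1 - beta 1%N <= gamma * sN it N.
  elim: N => [|N IH]; first by rewrite subrr /sN big_geq// mulr0.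
  rewrite /sN big_nat_recr//= mulrDr -lerBlDr (le_trans _ IH)//.
  rewrite (alg_beta hS N.+1).
  have h : gamma * rho gamma P it N.+1 * tau N.+1 * beta N.+1
      <= gamma * (beta N.+1 * tau N.+1).
    have -> : gamma * (beta N.+1 * tau N.+1) = gamma * tau N.+1 * beta N.+1 by ring.
    rewrite ler_pM2r ?beta_gt0// ler_pM2r ?tau_gt0//.
    by apply: ler_piMr; apply: ltW => //; exact: rho_lt1.
  by move: h; lra.
(* The factor 2 comes from the doubled gap sum in [energy_sum], the rest from
   [sN >= e * C ^+ 2 / gamma * N ^+ 2]. *)
have c30 : 0 < 2 * e * C ^+ 2 / gamma.
  by rewrite divr_gt0// mulr_gt0 ?exprn_gt0// mulr_gt0.
(* The summand 1 keeps the first constant positive when [M = 0]. *)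
exists (M / C + 1), (2 * e * C ^+ 2 / gamma); split=> //.
  by rewrite ltr_wpDl// divr_ge0// ltW.
move=> N N1; split.
  have N0 : 0 < N.+1%:R :> R by rewrite ltr0n.
  rewrite ler_pdivlMr//; apply: (@le_trans _ _ (M / C)); last by rewrite lerDl.
  rewrite ler_pdivlMr// -mulrA mulrC (le_trans _ (hM N))//.
  by rewrite ler_wpM2r ?enorm_ge0// mulrC.
have N0 : 0 < N%:R :> R by rewrite ltr0n.
apply: (le_trans (gap_mean_le N1)); rewrite lee_fin -energyE0.
have sum := energy_sum N.
have en0 : 0 <= beta N.+1 * energy N.
  rewrite mulr_ge0 ?(ltW (beta_gt0 _))//; have [h _] := energy_ge N.
  by apply: le_trans h; rewrite mulr_ge0 ?sqr_ge0 ?ltW.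
move: sum (weighted_gap_ge0 N); set S := \sum_(1 <= n < N.+1) _ => sum S0.
have sq : C ^+ 2 * N%:R ^+ 2 <= beta N.+1.
  rewrite -[beta N.+1]sqr_sqrtr ?(ltW (beta_gt0 _))// -exprMn.
  rewrite ler_pXn2r ?nnegrE ?sqrtr_ge0 ?mulr_ge0 ?ltW//.
  by rewrite (lt_le_trans _ (hC N))// ltr_pM2l// ltr_nat.
have b12 : beta 1%N = (1 - e) * beta 2.
  by rewrite /e subKr divfK// gt_eqF ?beta_gt0.
have e1 : e < 1 by rewrite /e ltrBlDr ltrDl divr_gt0 ?beta_gt0.
have b2N : beta 2 <= beta N.+1 by apply: beta_mono.
have s1 : e * C ^+ 2 / gamma * N%:R ^+ 2 <= sN it N.
  rewrite mulrAC ler_pdivrMr// (mulrC (sN _ _)) (le_trans _ (s_ge N))//.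
  apply: (@le_trans _ _ (e * beta N.+1)); first by rewrite -mulrA ler_pM2l.
  by rewrite b12; move: b2N e1; nra.
have c0 : 0 < e * C ^+ 2 / gamma * N%:R ^+ 2.
  by rewrite mulr_gt0 ?exprn_gt0// divr_gt0// mulr_gt0 ?exprn_gt0.
apply: (@le_trans _ _ (S / (e * C ^+ 2 / gamma * N%:R ^+ 2))).
  by rewrite ler_wpM2l// lef_pV2 ?posrE// (lt_le_trans c0).
have -> : beta 1%N / (2 * e * C ^+ 2 / gamma) * (energy 0 / N%:R ^+ 2)
    = (beta 1%N * energy 0 / 2) / (e * C ^+ 2 / gamma * N%:R ^+ 2).
  by field; rewrite !gt_eqF.
rewrite ler_pM2r ?invr_gt0// ler_pdivlMr//.
by move: sum en0; lra.
Qed.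

End algorithm.

Theorem theorem3 (R : realType) (q p : nat) (D : problem R q p) (gamma : R)
    (P : parameters R) (it : iterates R q p)
    (xs : 'rV[R]_q) (ys : 'rV[R]_p)
    (hD : admissible_strongly_convex D gamma)
    (hs : saddle_point D xs ys)
    (hP : valid_parameters P)
    (hS : aNPDAL_n D gamma P it) :
  exists C1 c3 : R, [/\ 0 < C1, 0 < c3 &
    forall N : nat, (1 <= N)%N ->
      enorm (x_ it N.+1 - xs) <= C1 / N.+1%:R /\
      (gap D xs ys (xhat it N) (yhat it N)
         <= (beta_ it 1 / c3 * (A1 gamma P it xs ys / N%:R ^+ 2))%:E)%E].
Proof. exact: aNPDAL_rates. Qed.
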